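(* Let $n\ge 2$ and $1\le r\le n$. Consider in $\mathbb{H}^n\times\mathbb{R}$ (half-space model) the vertical graphs $G$ with $H_r=0$ which are invariant by parabolic translations, i.e. graphs of the form $t=u(x_1,\ldots,x_{n-1},y)=\lambda(y)$. Apart from the slice ($\lambda$ constant), these graphs are, up to vertical translations or reflection, of the following types: (i) if $n=r$: $\lambda(y)=c\ln(y)$, for all $y>0$, with $c>0$; (ii) if $n>r$: $\lambda(y)=\frac{r}{n-r}\arcsin\left(\frac{y^{\frac{n-r}{r}}}{c}\right)$, for a positive constant $c$ and $y\in(0,c^{\frac{r}{n-r}})$. The function $\lambda$ in (i) gives rise to an entire vertical graph. The functions $\lambda$ in (ii) generate a family of non-entire horizontal $(r-1)$-minimal complete graphs in $\mathbb{H}^n\times\mathbb{R}$ invariant by parabolic translations. The asymptotic boundary of each graph of this family is formed by two parallel $(n-1)$-planes.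
   Context: Half-space model: $\mathbb{H}^n=\{(x_1,\ldots,x_{n-1},y)\in\mathbb{R}^n: y>0\}$ with metric $\frac{dx_1^2+\cdots+dx_{n-1}^2+dy^2}{y^2}$; $\mathbb{H}^n\times\mathbb{R}$ has the product metric, with $t$ the coordinate on $\mathbb{R}$. A slice is $\mathbb{H}^n\times\{t_0\}$. Parabolic translations are the Euclidean translations in the variables $(x_1,\ldots,x_{n-1})$. For an oriented $n$-dimensional hypersurface with principal curvatures $k_1,\ldots,k_n$, $H_r=\binom{n}{r}^{-1}\sum_{i_1<\cdots<i_r}k_{i_1}\cdots k_{i_r}$; the hypersurface is called $(r-1)$-minimal if $H_r=0$. Vertical graphs here are graphs $t=\lambda(y)$ of $C^2$ functions defined on maximal intervals of $y$; an entire vertical graph is one defined over all of $\mathbb{H}^n$. Reflection means reflection through a slice. A horizontal graph is a hypersurface of the form $y=g(x_1,\ldots,x_{n-1},t)$ with $g$ real and positive. In case (ii), ''generate'' means: setting $y_0=c^{r/(n-r)}$ and $t_0=\lim_{y\to y_0}\lambda(y)$, the graph $t=\lambda(y)$ is glued along $y=y_0$ (where it is vertical) with its reflection $t=2t_0-\lambda(y)$. The asymptotic boundary is the set of points of $\{y=0\}\times\mathbb{R}$ lying in the closure of the hypersurface in $\{(x_1,\ldots,x_{n-1},y,t): y\ge 0\}$. *)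

(* Defs.v *)
From HB Require Import structures.
From mathcomp Require Import all_boot all_order all_algebra.
From mathcomp Require Import all_classical all_reals all_analysis.

Set Implicit Arguments.
Unset Strict Implicit.
Unset Printing Implicit Defensive.

Import Order.TTheory GRing.Theory Num.Theory.
Import numFieldNormedType.Exports.

Local Open Scope classical_set_scope.
Local Open Scope ring_scope.

Section Smoothness.
Variable R : realType.

Definition pder k (W : normedModType R) (i : 'I_k) (f : 'rV[R]_k -> W)
  : 'rV[R]_k -> W := fun p => 'D_(delta_mx 0 i) f p.

(* Used on open sets only. *)
Definition C1_on k (W : normedModType R) (U : set 'rV[R]_k)
    (f : 'rV[R]_k -> W) : Prop :=
  forall p i, U p ->
    derivable f p (delta_mx 0 i) /\ {for p, continuous (pder i f)}.

Definition C2_on k (W : normedModType R) (U : set 'rV[R]_k)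
    (f : 'rV[R]_k -> W) : Prop :=
  C1_on U f /\ forall i, C1_on U (pder i f).

Definition C2_real (I : set R) (f : R -> R) : Prop :=
  forall y, I y ->
    [/\ derivable f y 1, derivable (derive1 f) y 1
      & {for y, continuous (derive1n 2 f)}].

End Smoothness.

(* A Riemannian metric on an open set of R^k is given by its matrix of
   coefficients [G] in the standard coordinates. *)
Section Riemannian.
Variables (R : realType) (k : nat) (G : 'rV[R]_k -> 'M[R]_k).

Definition inner (p v w : 'rV[R]_k) : R := (v *m G p *m w^T) 0 0.

(* [christoffel l a b p] is the symbol with upper index [l] and lower
   indices [a], [b], for the Levi-Civita connection of [G]. *)
Definition christoffel (l a b : 'I_k) (p : 'rV[R]_k) : R :=
  2^-1 * \sum_s invmx (G p) l s *
    (pder a (fun q => G q b s) p + pder b (fun q => G q a s) p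
     - pder s (fun q => G q a b) p).

Definition C1_curve (gam : R -> 'rV[R]_k) : Prop :=
  forall s, derivable gam s 1 /\ {for s, continuous (derive1 gam)}.

Definition curve_length (gam : R -> 'rV[R]_k) : \bar R :=
  (\int[lebesgue_measure]_(s in `[0%R, 1%R])
     (Num.sqrt (inner (gam s) (derive1 gam s) (derive1 gam s)))%:E)%E.

(* Intrinsic distance of a submanifold [S].  Curves are parametrized by [0, 1];
   asking C^1 regularity on the whole line is no restriction, and curves need
   not be regular, so that piecewise C^1 curves would give the same infimum. *)
Definition intrinsic_dist (S : set 'rV[R]_k) (p q : 'rV[R]_k) : \bar R :=
  ereal_inf [set curve_length gam | gam in
    [set gam | [/\ C1_curve gam, gam 0 = p, gam 1 = q
                 & forall s, 0 <= s <= 1 -> S (gam s)]]].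

Definition complete_submanifold (S : set 'rV[R]_k) : Prop :=
  forall u : nat -> 'rV[R]_k, (forall i, S (u i)) ->
    (forall e : R, 0 < e -> exists N, forall i j, (N <= i)%N -> (N <= j)%N ->
       (intrinsic_dist S (u i) (u j) < e%:E)%E) ->
    exists2 p, S p &
      forall e : R, 0 < e -> exists N, forall i, (N <= i)%N ->
        (intrinsic_dist S (u i) p < e%:E)%E.

End Riemannian.

Section Hypersurface.
Variables (R : realType) (k : nat) (G : 'rV[R]_k.+1 -> 'M[R]_k.+1).
Variable phi : 'rV[R]_k -> 'rV[R]_k.+1.

Definition first_form (p : 'rV[R]_k) : 'M[R]_k :=
  \matrix_(i, j) inner G (phi p) (pder i phi p) (pder j phi p).

(* Covariant derivative, along [phi], of its [j]-th tangent field in the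
   direction of the [i]-th one. *)
Definition cov_der (i j : 'I_k) (p : 'rV[R]_k) : 'rV[R]_k.+1 :=
  pder i (pder j phi) p +
  \row_l \sum_a \sum_b
    christoffel G l a b (phi p) * pder i phi p 0 a * pder j phi p 0 b.

Definition unit_normal (p : 'rV[R]_k) (nu : 'rV[R]_k.+1) : Prop :=
  inner G (phi p) nu nu = 1 /\
  forall i, inner G (phi p) (pder i phi p) nu = 0.

Definition second_form (nu : 'rV[R]_k.+1) (p : 'rV[R]_k) : 'M[R]_k :=
  \matrix_(i, j) inner G (phi p) (cov_der i j p) nu.

Definition shape_operator (nu : 'rV[R]_k.+1) (p : 'rV[R]_k) : 'M[R]_k :=
  invmx (first_form p) *m second_form nu p.

(* Eigenvalues of the shape operator, counted with multiplicity. *)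
Definition principal_curvatures (nu : 'rV[R]_k.+1) (p : 'rV[R]_k)
    (kap : 'I_k -> R) : Prop :=
  char_poly (shape_operator nu p) = \prod_i ('X - (kap i)%:P).

Definition mean_curvature (r : nat) (kap : 'I_k -> R) : R :=
  ('C(k, r)%:R)^-1 * \sum_(A : {set 'I_k} | #|A| == r) \prod_(i in A) kap i.

(* [phi] parametrizes over [U] an oriented immersed C^2 hypersurface of the
   Riemannian manifold (M, G), whose r-th mean curvature vanishes. *)
Definition Hr_zero (M : set 'rV[R]_k.+1) (r : nat) (U : set 'rV[R]_k) : Prop :=
  [/\ open U, C2_on U phi,
      forall p, U p -> M (phi p) /\ row_free (\matrix_i pder i phi p)
    & exists nu : 'rV[R]_k -> 'rV[R]_k.+1, forall p, U p ->
        [/\ {for p, continuous nu}, unit_normal p (nu p)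
          & exists2 kap, principal_curvatures (nu p) p kap
                       & mean_curvature r kap = 0]].

End Hypersurface.

(* Points of H^n x R are rows (x_1, ..., x_{n-1}, y, t) of length n + 1, and
   points of H^n, or of a chart, rows of length n.  These lengths are written
   [n.-1.+2] and [n.-1.+1], which are n + 1 and n for n >= 1. *)
Section HnR.
Variables (R : realType) (n : nat).

Definition chart := 'rV[R]_n.-1.+1.
Definition hpoint := 'rV[R]_n.-1.+2.

Definition it : 'I_n.-1.+2 := ord_max.
Definition iy : 'I_n.-1.+2 := lift ord_max ord_max.

Definition tcoord (p : hpoint) : R := p 0 it.
Definition ycoord (p : hpoint) : R := p 0 iy.

Definition hyp_y (q : chart) : R := q 0 ord_max.
Definition hyp : set chart := [set q | 0 < hyp_y q].

Definition HnR : set hpoint := [set p | 0 < ycoord p].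
Definition HnR_metric (p : hpoint) : 'M[R]_n.-1.+2 :=
  diag_mx (\row_i (if i == it then 1 else (ycoord p) ^- 2)).

(* The graph map placing [u q] in the coordinate [i0] and the entries of [q],
   in order, in the other coordinates.  For [i0 := iy] the chart coordinates
   are thus (x_1, ..., x_{n-1}, t). *)
Definition graph_map (i0 : 'I_n.-1.+2) (u : chart -> R) (q : chart) : hpoint :=
  \row_i (if unlift i0 i is Some j then q 0 j else u q).

Definition minimal_graph (i0 : 'I_n.-1.+2) (r : nat) (D : set chart)
    (u : chart -> R) : Prop :=
  Hr_zero HnR_metric (graph_map i0 u) HnR r D.

Definition strip (I : set R) : set chart := [set q | I (hyp_y q)].

(* The set t = lam(y), y in I. *)
Definition vgraph (I : set R) (lam : R -> R) : set hpoint :=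
  graph_map it (lam \o hyp_y) @` strip I.

(* C^2 functions on open intervals of y > 0 whose graph t = lam(y) has
   H_r = 0. *)
Definition parabolic_solution (r : nat) (I : set R) (lam : R -> R) : Prop :=
  [/\ open I, is_interval I, I !=set0, I `<=` [set y | 0 < y]
    & C2_real I lam /\ minimal_graph it r (strip I) (lam \o hyp_y)].

Definition maximal_parabolic_solution (r : nat) (I : set R) (lam : R -> R)
  : Prop :=
  parabolic_solution r I lam /\
  forall (J : set R) (mu : R -> R), parabolic_solution r J mu ->
    I `<=` J -> (forall y, I y -> mu y = lam y) -> J = I.

(* The two alternatives are a vertical translation by [b], and a reflection
   through the slice at height [b / 2]. *)
Definition vertically_congruent (I : set R) (lam : R -> R)
    (J : set R) (mu : R -> R) : Prop :=
  I = J /\ exists b : R,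
    (forall y, I y -> lam y = mu y + b) \/
    (forall y, I y -> lam y = b - mu y).

Definition entire_vertical_graph (S : set hpoint) : Prop :=
  exists u : chart -> R, S = graph_map it u @` hyp.

(* S is the hypersurface y = g(x, t), (x, t) in D. *)
Definition horizontal_graph (S : set hpoint) (D : set chart) (g : chart -> R)
  : Prop :=
  [/\ open D, forall q, D q -> 0 < g q & S = graph_map iy g @` D].

Definition parabolic_invariant (S : set hpoint) : Prop :=
  forall p v : hpoint, ycoord v = 0 -> tcoord v = 0 -> S p -> S (p + v).

(* The graph of lam over (0, y0), its reflection through the slice t = t0, and
   the locus y = y0, t = t0 along which they are glued. *)
Definition glued (lam : R -> R) (y0 t0 : R) : set hpoint :=
  vgraph `]0, y0[ lam `|` [set p | ycoord p = y0 /\ tcoord p = t0]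
    `|` vgraph `]0, y0[ (fun y => 2 * t0 - lam y).

Definition asymptotic_boundary (S : set hpoint) : set hpoint :=
  closure S `&` [set p | ycoord p = 0].

(* Two distinct parallel affine d-planes, with direction the row space of W. *)
Definition parallel_planes (d : nat) (P Q : set hpoint) : Prop :=
  exists (W : 'M[R]_(d, n.-1.+2)) (a b : hpoint),
    [/\ row_free W, P = [set a + w *m W | w in [set: 'rV[R]_d]],
        Q = [set b + w *m W | w in [set: 'rV[R]_d]] & P <> Q].

End HnR.

Arguments vgraph {R} n I lam _.
Arguments glued {R} n lam y0 t0 _.

Definition log_profile (R : realType) (c : R) : R -> R := fun y => c * ln y.

(* The exponent (n - r) / r, for r < n. *)
Definition arcsin_exponent (R : realType) (n r : nat) : R :=
  (n%:R - r%:R) / r%:R.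

Definition arcsin_profile (R : realType) (n r : nat) (c : R) : R -> R :=
  fun y => r%:R / (n%:R - r%:R) * asin (y `^ arcsin_exponent R n r / c).

Definition arcsin_end (R : realType) (n r : nat) (c : R) : R :=
  c `^ (r%:R / (n%:R - r%:R)).

(* Main.v *)
(* A graph t = lam(y) has principal curvatures a = - y lam' / W (n - 1 times) and
   b = y (y lam')' / W^3, with W^2 = 1 + (y lam')^2, so that H_r = 0 amounts to
   a^(r-1) ((n - r) a + r b) = 0.  With v = y lam' and alpha = (n - r) / r, this
   says that h = v / sqrt (1 + v^2) * y^(-alpha), which is sin (arctan v) divided
   by y^alpha, satisfies h^(r-1) h' = 0, hence that h is constant; the solutions
   are then found by one integration.  The glued hypersurface is the
   horizontal graph y = (c sin (alpha t))^(1/alpha), 0 < t < pi/alpha.  On it y is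
   bounded, so lengths of curves control the variations of t, ln y and x.  Along
   a Cauchy sequence ln y is bounded below, which keeps the limit of t inside
   the open interval; explicit curves then show convergence in the
   intrinsic distance. *)
Require Import Defs.
From HB Require Import structures.
From mathcomp Require Import all_boot all_order all_algebra.
From mathcomp Require Import all_classical all_reals all_analysis.
From mathcomp Require Import measurable_realfun ring lra.

Import Order.TTheory GRing.Theory Num.Theory.
Import numFieldNormedType.Exports.

Local Open Scope classical_set_scope.
Local Open Scope ring_scope.

Set Implicit Arguments.
Unset Strict Implicit.
Unset Printing Implicit Defensive.

(** * Curvatures *)

(** The slope of lambda is infinite at the end of its interval, so neither the regularity of the
    glued hypersurface nor its equation can be read off from the two vertical halves. The curvature
    is therefore computed once, for the hypersurface swept out by parabolic translations of an
    arbitrary regular curve (Y(s), T(s)): Y = id gives the vertical graphs, T = id the horizontal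
    one. The constant h also governs the domain: |h| y^alpha is the absolute value of a sine of
    arctan v, hence less than 1. For alpha > 0 and h nonzero this bounds y by |h|^(-1/alpha), and
    since any extension of a solution keeps the same |h|, it yields maximality as well as the
    constant c = 1/|h|. In the completeness proof, admissible curves are differentiable on the whole
    line while the profile is only controlled for 0 < t < pi/alpha. Affine interpolation of t would
    leave this interval outside [0, 1], hence the parametrization by a squared sine. *)

Lemma sum_set_prodE (R : comNzRingType) k r (kap : 'I_k -> R) :
  \sum_(A : {set 'I_k} | #|A| == r) \prod_(i in A) kap i =
  (\prod_i (kap i *: 'X + 1))`_r.
Proof.
rewrite bigA_distr /= coef_sum [RHS](bigID (fun A : {set 'I_k} => #|A| == r))/=.
rewrite [X in _ + X]big1 ?addr0; last first.
  move=> A /negPf Ar; rewrite -big_mkcond/= scaler_prod prodr_const.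
  by rewrite coefZ coefXn eq_sym Ar mulr0.
apply: eq_bigr => A /eqP Ar; rewrite -big_mkcond/= scaler_prod prodr_const.
by rewrite coefZ coefXn Ar eqxx mulr1.
Qed.

(** Unique factorization makes the two families permutations of each other, and the coefficient of
    X^r in the product of the factors k X + 1 does not see the order. Hence the vanishing of H_r
    does not depend on the eigenvalue list chosen in [Hr_zero]. *)
Lemma mean_curvature_eq (R : realType) k r (kap d : 'I_k -> R) :
  \prod_i ('X - (kap i)%:P) = \prod_i ('X - (d i)%:P) ->
  mean_curvature r kap = mean_curvature r d.
Proof.
move=> kapd; rewrite /mean_curvature !sum_set_prodE; congr (_ * _`__).
have E (f : 'I_k -> R) : \prod_i (f i *: 'X + 1) =
    \prod_(x <- [seq f i | i : 'I_k]) (x *: 'X + 1).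
  by rewrite big_map big_enum.
rewrite !E (@perm_big _ _ _ _ [seq kap i | i : 'I_k] [seq d i | i : 'I_k])//.
by apply: prod_XsubC_eq; rewrite !big_image.
Qed.

(** In (a X + 1)^m (b X + 1) the coefficient of X^(s+1) is C(m,s+1) a^(s+1) + C(m,s) a^s b, and
    C(m,s) factors out after multiplication by s + 1. *)
Lemma mean_curvature_split_eq0 (R : realType) m s (a b : R) : (s <= m)%N ->
  mean_curvature s.+1 (fun i : 'I_m.+1 => if i == ord_max then b else a) = 0
  <-> a ^+ s * ((m - s)%:R * a + s.+1%:R * b) = 0.
Proof.
move=> sm; have cb p : ((a *: 'X + 1 : {poly R}) ^+ m)`_p = 'C(m, p)%:R * a ^+ p.
  rewrite addrC exprDn coef_sum.
  under eq_bigr do rewrite expr1n mul1r exprZn coefMn coefZ coefXn.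
  have [pm|mp] := ltnP p m.+1.
    rewrite (bigD1 (Ordinal pm))//= eqxx mulr1 big1 ?addr0 ?mulr_natl// => i.
    by rewrite -val_eqE/= eq_sym => /negPf ->; rewrite mulr0 mul0rn.
  rewrite bin_small// mul0r big1// => i _.
  by rewrite [p == _]gtn_eqF ?mulr0 ?mul0rn// (leq_ltn_trans _ mp)// -ltnS.
rewrite /mean_curvature sum_set_prodE (bigD1 ord_max)//= eqxx.
rewrite (eq_bigr (fun=> a *: 'X + 1)); last by move=> i /negPf ->.
rewrite prodr_const cardC1 card_ord /= mulrDl mul1r coefD.
rewrite -scalerAl coefZ mulrC coefXM /=.
rewrite ?coefXM /= ?cb.
set N := (X in X / _).
(* The identity (s+1) C(m,s+1) = (m-s) C(m,s) is used; it also covers s = m, where both sides are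
   zero. *)
have NE : s.+1%:R * N = 'C(m, s)%:R * (a ^+ s * ((m - s)%:R * a + s.+1%:R * b)).
  have := congr1 (fun x => x%:R : R) (mul_bin_left m s); rewrite !natrM => bl.
  by rewrite /N mulrDr !mulrA bl exprS; ring.
have s0 : (s.+1%:R : R) != 0 by rewrite pnatr_eq0.
have C0 : ('C(m.+1, s.+1)%:R : R)^-1 != 0.
  by rewrite invr_eq0 pnatr_eq0 -lt0n bin_gt0.
have Cms : ('C(m, s)%:R : R) != 0 by rewrite pnatr_eq0 -lt0n bin_gt0.
split=> [/eqP|E0]; last first.
  by apply/eqP; rewrite mulf_eq0 -(mulrI_eq0 N (mulfI s0)) NE E0 mulr0 eqxx.
rewrite mulf_eq0 (negPf C0) orbF -(mulrI_eq0 N (mulfI s0)) NE.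
by rewrite mulf_eq0 (negPf Cms) => /eqP.
Qed.

(** * The ordinary differential equation *)

Section RealDerivatives.
Variable R : realType.
Implicit Types (f g : R -> R) (x : R).

Lemma is_derive_mul f g x a b : is_derive x 1 f a -> is_derive x 1 g b ->
  is_derive x 1 (fun y => f y * g y) (a * g x + f x * b).
Proof.
move=> df dg; have -> : (fun y => f y * g y) = f * g by [].
apply: (is_derive_eq (is_deriveM df dg)).
by rewrite /GRing.scale/= addrC [g x * _]mulrC.
Qed.

Lemma is_derive_add f g x a b : is_derive x 1 f a -> is_derive x 1 g b ->
  is_derive x 1 (fun y => f y + g y) (a + b).
Proof.
move=> df dg; have -> : (fun y => f y + g y) = f + g by [].
exact: is_deriveD.
Qed.

Lemma is_derive_inv f x a : f x != 0 -> is_derive x 1 f a ->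
  is_derive x 1 (fun y => (f y)^-1) (- a / f x ^+ 2).
Proof.
move=> f0 df; apply: (is_derive_eq (is_deriveV f0 df)).
by rewrite /GRing.scale/= mulrC mulrN mulNr.
Qed.

Lemma is_derive_exp f x a n : is_derive x 1 f a ->
  is_derive x 1 (fun y => f y ^+ n.+1) (n.+1%:R * f x ^+ n * a).
Proof.
move=> df; have -> : (fun y => f y ^+ n.+1) = f ^+ n.+1.
  by apply/funext => y; rewrite exprfctE.
exact: is_deriveX.
Qed.

Lemma is_derive_comp f g x a b : is_derive (g x) 1 f a -> is_derive x 1 g b ->
  is_derive x 1 (fun y => f (g y)) (a * b).
Proof. by move=> df dg; exact: is_derive1_comp. Qed.

Lemma is_derive_near f g x a : (\near x, f x = g x) ->
  is_derive x 1 f a -> is_derive x 1 g a.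
Proof. exact: near_eq_is_derive. Qed.

Lemma is_derive_continuous f x a : is_derive x 1 f a -> {for x, continuous f}.
Proof.
by move=> [df _]; apply/differentiable_continuous/derivable1_diffP.
Qed.

Lemma is_derive_derive1 f x a : is_derive x 1 f a -> derive1 f x = a.
Proof. by move=> [_ fa]; rewrite derive1E. Qed.

Lemma derive1_is_derive f x : derivable f x 1 -> is_derive x 1 f (derive1 f x).
Proof. by move=> df; rewrite derive1E; exact: derivableP. Qed.

Lemma is_interval_derive0_cst (I : set R) f : is_interval I ->
  (forall x, I x -> is_derive x 1 f 0) -> forall x y, I x -> I y -> f x = f y.
Proof.
move=> itvI df x y; wlog xy : x y / x <= y.
  by move=> H Ix Iy; have [/H|/ltW /H] := leP x y; [apply|move=> ->].
move=> Ix Iy; have sub z : z \in `[x, y] -> I z.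
  by rewrite in_itv/= => xzy; exact: itvI xzy.
have [||c _] := @MVT_segment R f (fun=> 0) x y xy.
- by move=> z zI; apply/df/sub/subset_itv_oo_cc.
- apply: derivable_within_continuous => z zI.
  by have [] := df _ (sub _ zI).
- by rewrite mul0r => /eqP; rewrite subr_eq0 => /eqP.
Qed.

(* Where the power vanishes the derivative is unknown, but both [f ^+ s.+1] and
   [f ^+ s.+2] have zero derivative everywhere, and their quotient is [f]. *)
Lemma is_interval_exp_derive0_cst (I : set R) f df s : is_interval I ->
  (forall x, I x -> is_derive x 1 f (df x)) ->
  (forall x, I x -> f x ^+ s * df x = 0) ->
  forall x y, I x -> I y -> f x = f y.
Proof.
move=> itvI fdf f0 x y Ix Iy.
have cst k z : I z -> is_derive z 1 (fun y => f y ^+ (s + k).+1) 0.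
  move=> Iz; apply: (is_derive_eq (is_derive_exp _ (fdf _ Iz))).
  by rewrite -mulrA addnC exprD -mulrA f0// !mulr0.
have := is_interval_derive0_cst itvI (cst 1%N) Ix Iy.
have := is_interval_derive0_cst itvI (cst 0%N) Ix Iy.
rewrite /= addn0 addn1 => fs; rewrite !(exprS _ s.+1) fs.
have [/eqP|fs0] := eqVneq (f y ^+ s.+1) 0; last exact: mulIf.
by rewrite expf_eq0/= => /eqP fy; move: fs; rewrite fy expr0n => /eqP;
  rewrite expf_eq0/= => /eqP ->.
Qed.

End RealDerivatives.

(** The function [derive1 f] is only known to be [l1] on [I]. Openness turns this into equality near
    each point, which can be differentiated once more. *)
Lemma C2_real_of (R : realType) (I : set R) (f l1 l2 : R -> R) : open I ->
  (forall y, I y -> is_derive y 1 f (l1 y)) ->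
  (forall y, I y -> is_derive y 1 l1 (l2 y)) ->
  (forall y, I y -> {for y, continuous l2}) ->
  [/\ C2_real I f, forall y, I y -> derive1 f y = l1 y
    & forall y, I y -> derive1n 2 f y = l2 y].
Proof.
move=> oI d1 d2 c2.
have near_I y : I y -> \near y, I y by move=> Iy; exact: open_nbhs_nbhs.
have e1 y : I y -> derive1 f y = l1 y by move=> /d1/is_derive_derive1.
have d2' y : I y -> is_derive y 1 (derive1 f) (l2 y).
  move=> Iy; apply: is_derive_near (d2 _ Iy).
  by near=> z; rewrite e1//; near: z; exact: near_I.
have e2 y : I y -> derive1n 2 f y = l2 y by move=> /d2'/is_derive_derive1.
split=> // y Iy; split.
- by have [] := d1 _ Iy.
- by have [] := d2' _ Iy.
- have E2 := e2 _ Iy; suff : derive1n 2 f z @[z --> y] --> derive1n 2 f y by [].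
  rewrite E2; apply: cvg_trans (c2 _ Iy).
  apply: near_eq_cvg; near=> z; rewrite e2//; near: z; exact: near_I.
Unshelve. all: by end_near. Qed.

(** * The first integral of the equation *)

Section FirstIntegral.
Variables (R : realType) (alpha : R).
Implicit Types (I : set R) (v lam : R -> R).

(* sin (arctan v) *)
Definition sine (v : R) : R := v / Num.sqrt (1 + v ^+ 2).

Lemma onePsqr_gt0 (v : R) : 0 < 1 + v ^+ 2.
Proof. by rewrite ltr_pwDl// sqr_ge0. Qed.

Lemma sine_sqr (v : R) : 1 - sine v ^+ 2 = (1 + v ^+ 2)^-1.
Proof.
rewrite expr_div_n sqr_sqrtr ?ltW ?onePsqr_gt0//.
have := onePsqr_gt0 v; set w := 1 + _ => w0.
by rewrite -[1](@divff _ w) ?gt_eqF// -mulrBl addrK mul1r.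
Qed.

(** Write v = tan(theta) with |theta| < pi/2: then z = sin(theta), and cos(theta) > 0 is the square
    root of 1 - z^2. *)
Lemma sine_inv (v z : R) : sine v = z ->
  `|z| < 1 /\ v = z / Num.sqrt (1 - z ^+ 2).
Proof.
move=> <-; split.
  rewrite -(@ltr_pXn2r _ 2)// ?nnegrE// expr1n real_normK ?num_real//.
  by rewrite -subr_gt0 sine_sqr invr_gt0 onePsqr_gt0.
rewrite sine_sqr sqrtrV ?ltW ?onePsqr_gt0// invrK /sine divfK//.
by rewrite sqrtr_eq0 -ltNge onePsqr_gt0.
Qed.

Lemma sine_first_integral I v dv s : is_interval I -> I `<=` [set y | 0 < y] ->
  (forall y, I y -> is_derive y 1 v (dv y)) ->
  (forall y, I y -> v y ^+ s * (alpha * v y * (1 + v y ^+ 2) - y * dv y) = 0) ->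
  exists k, forall y, I y -> sine (v y) = k * y `^ alpha.
Proof.
move=> itvI I0 vdv Ev; pose f y := sine (v y) * (y `^ alpha)^-1.
pose w y := Num.sqrt (1 + v y ^+ 2).
have w0 y : 0 < w y by rewrite sqrtr_gt0 onePsqr_gt0.
have w2 y : w y ^+ 2 = 1 + v y ^+ 2 by rewrite sqr_sqrtr// ltW// onePsqr_gt0.
have df y : I y -> is_derive y 1 f
    (- (alpha * v y * (1 + v y ^+ 2) - y * dv y)
     / (w y ^+ 3 * y * y `^ alpha)).
  move=> Iy; have y0 := I0 _ Iy; have dvy := vdv _ Iy.
  have dw : is_derive y 1 w (v y * dv y / w y).
    have d1 := is_derive_add (is_derive_cst (1 : R) y 1) (is_derive_exp 1 dvy).
    have d2 := is_derive1_sqrt (onePsqr_gt0 (v y)).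
    apply: (is_derive_eq (is_derive_comp (g := fun z => 1 + v z ^+ 2) d2 d1)).
    have := w0 y; rewrite /w; set W := Num.sqrt _ => W0.
    by rewrite expr1; field; rewrite gt_eqF.
  have ya0 : 0 < y `^ alpha by exact: powR_gt0.
  have wy0 := w0 y.
  have d1 := is_derive_inv (lt0r_neq0 wy0) dw.
  have d2 := is_derive_inv (f := (@powR R)^~ alpha) (lt0r_neq0 ya0)
    (is_derive1_powR alpha y0).
  have d3 := is_derive_mul (is_derive_mul dvy d1) d2.
  apply: (is_derive_eq d3).
  rewrite /= powRB; last by rewrite (gt_eqF y0) implybT.
  rewrite powRr1 ?ltW// -w2 -[y * dv y]mulr1.
  (* Writing the factor 1 as w^2 - v^2 makes the identity rational in v, w and y, so that [field]
     closes it. *)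
  have -> : 1 = w y ^+ 2 - v y ^+ 2 by rewrite w2 addrK.
  by field; rewrite !gt_eqF.
case: (pselect (I !=set0)) => [[z Iz]|noI]; last first.
  by exists 0 => y Iy; case: noI; exists y.
exists (f z) => y Iy.
have ya0 : y `^ alpha != 0 by rewrite gt_eqF// powR_gt0// I0.
suff -> : f z = f y by rewrite /f divfK.
apply: (is_interval_exp_derive0_cst (s := s) itvI df) => // x Ix.
(* Either [v ^+ s] vanishes, and then [f ^+ s] does too, or the other factor vanishes, and with it
   the derivative of [f]. *)
have /eqP := Ev _ Ix; rewrite mulf_eq0 => /orP[]/eqP E0.
  by rewrite /f /sine !expr_div_n E0 !mul0r.
by rewrite E0 oppr0 mul0r mulr0.
Qed.

(* [v] stands for y lam'; away from its zeros, H_r = 0 says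
   y v' = alpha v (1 + v^2). *)
Definition solution I v lam := forall y, I y ->
  is_derive y 1 lam (v y / y) /\
  is_derive y 1 v (alpha * v y * (1 + v y ^+ 2) / y).

Lemma solution_derive2 I v lam : open I -> I `<=` [set y | 0 < y] ->
  solution I v lam -> C2_real I lam /\ forall y, I y ->
    derive1 lam y = v y / y /\
    derive1 lam y + y * derive1n 2 lam y = alpha * v y * (1 + v y ^+ 2) / y.
Proof.
move=> oI I0 sol.
pose l2 y := (alpha * v y * (1 + v y ^+ 2) / y - v y / y) / y.
have d2 y : I y -> is_derive y 1 (fun z => v z / z) (l2 y).
  move=> Iy; have [_ dv] := sol _ Iy; have y0 : y != 0 by rewrite gt_eqF ?I0.
  have di := is_derive_inv (f := id) y0 (is_derive_id y 1).
  apply: (is_derive_eq (is_derive_mul dv di)).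
  by rewrite /l2 /=; field.
have c2 y : I y -> {for y, continuous l2}.
  move=> Iy; have [_ /is_derive_continuous cv] := sol _ Iy.
  have y0 : y != 0 by rewrite gt_eqF ?I0.
  have ci : {for y, continuous (@GRing.inv R)} by exact: inv_continuous.
  apply: cvgM => //; apply: cvgB; last exact: cvgM.
  apply: cvgM => //; apply: cvgM; first by apply: cvgM => //; exact: cvg_cst.
  by apply: cvgD; [exact: cvg_cst|apply: cvgM].
have [C2 e1 e2] := C2_real_of oI (fun y Iy => (sol y Iy).1) d2 c2.
split=> // y Iy; rewrite e1// e2// /l2; split=> //.
by field; rewrite gt_eqF ?I0.
Qed.

End FirstIntegral.

(** * Explicit solutions *)

Section Profiles.
Variables (R : realType) (alpha : R).
Implicit Types (I : set R) (v lam mu : R -> R).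

(* H_r = 0 at height [y] for t = lam(y), up to a nonzero factor, with r = s + 1,
   l1 = lam' and l2 = lam''. *)
Definition radial_eq s (y l1 l2 : R) : Prop :=
  (y * l1) ^+ s *
  (alpha * (y * l1) * (1 + (y * l1) ^+ 2) - y * (l1 + y * l2)) = 0.

Lemma solution_radial_eq I v lam s : open I -> I `<=` [set y | 0 < y] ->
  solution alpha I v lam ->
  forall y, I y -> radial_eq s y (derive1 lam y) (derive1n 2 lam y).
Proof.
move=> oI I0 sol y Iy; have y0 : y != 0 by rewrite gt_eqF ?I0.
have [_ /(_ y Iy)[l1 l2]] := solution_derive2 oI I0 sol.
have v1 : y * derive1 lam y = v y by rewrite l1 mulrC divfK.
by rewrite /radial_eq v1 l2 [y * (_ / y)]mulrC divfK// subrr mulr0.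
Qed.

Lemma radial_first_integral I lam s : is_interval I ->
  I `<=` [set y | 0 < y] -> C2_real I lam ->
  (forall y, I y -> radial_eq s y (derive1 lam y) (derive1n 2 lam y)) ->
  exists k, forall y, I y -> sine (y * derive1 lam y) = k * y `^ alpha.
Proof.
move=> itvI I0 C2 E.
apply: (@sine_first_integral _ _ _ (fun y => y * derive1 lam y)
  (fun y => derive1 lam y + y * derive1n 2 lam y) s) => // y Iy.
have [_ d2 _] := C2 _ Iy.
apply: (is_derive_eq (is_derive_mul (is_derive_id y 1) (derive1_is_derive d2))).
by rewrite mul1r.
Qed.

Lemma solution_eq I v lam mu : open I -> (forall y, I y -> mu y = lam y) ->
  solution alpha I v mu -> solution alpha I v lam.
Proof.
move=> oI lm sol y Iy; have [d1 d2] := sol _ Iy; split=> //.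
apply: is_derive_near d1; near=> z; rewrite lm//.
by near: z; exact: open_nbhs_nbhs.
Unshelve. all: by end_near. Qed.

Lemma solution_shift I v lam b :
  solution alpha I v lam -> solution alpha I v (fun y => lam y + b).
Proof.
move=> sol y Iy; have [d1 d2] := sol _ Iy; split=> //.
by apply: (is_derive_eq (is_derive_add d1 (is_derive_cst b y 1))); rewrite addr0.
Qed.

Lemma solution_reflect I v lam b : solution alpha I v lam ->
  solution alpha I (fun y => - v y) (fun y => b - lam y).
Proof.
move=> sol y Iy; have [d1 d2] := sol _ Iy; split.
  apply: (is_derive_eq (is_derive_add (is_derive_cst b y 1) (is_deriveN d1))).
  by rewrite add0r mulNr.
by apply: (is_derive_eq (is_deriveN d2)); rewrite sqrrN mulrN !mulNr.
Qed.

Lemma solution_cst I b : solution alpha I (fun=> 0) (fun=> b).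
Proof.
move=> y Iy; split.
  by apply: (is_derive_eq (is_derive_cst b y 1)); rewrite mul0r.
by apply: (is_derive_eq (is_derive_cst 0 y 1)); rewrite mulr0 !mul0r.
Qed.

Lemma solution_ln c : alpha = 0 ->
  solution alpha [set y | 0 < y] (fun=> c) (log_profile c).
Proof.
move=> a0 y y0; split.
  by apply: (is_derive_eq (is_derive_mul (is_derive_cst c y 1)
    (is_derive1_ln y0))); rewrite mul0r add0r.
by apply: (is_derive_eq (is_derive_cst c y 1)); rewrite a0 !mul0r.
Qed.

Definition asin_profile c (y : R) : R := alpha^-1 * asin (y `^ alpha / c).

Hypothesis a0 : 0 < alpha.

Lemma powR_lt_endE c y : 0 < c -> 0 < y ->
  (y `^ alpha / c < 1) = (y < c `^ alpha^-1).
Proof.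
move=> c0 y0; rewrite ltr_pdivrMr// mul1r.
have cE : (c `^ alpha^-1) `^ alpha = c.
  by rewrite -powRrM mulVf ?gt_eqF// powRr1 // ltW.
have [yc|cy] := ltP y (c `^ alpha^-1).
  by rewrite -[X in _ < X]cE gt0_ltr_powR// nnegrE ?powR_ge0// ltW.
apply/negbTE; rewrite -leNgt -[X in X <= _]cE.
by rewrite ge0_ler_powR// ?nnegrE ?powR_ge0// ltW.
Qed.

(** With z = sin(theta), the relation y z' = alpha z gives y theta' = alpha tan(theta). Thus v =
    tan(theta) satisfies y v' = alpha v (1 + v^2), and alpha^-1 theta has derivative v / y. *)
Lemma solution_asin c : 0 < c ->
  let z y := y `^ alpha / c in
  solution alpha `]0, c `^ alpha^-1[ (fun y => z y / Num.sqrt (1 - z y ^+ 2))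
    (asin_profile c).
Proof.
move=> c0 z y; rewrite /= in_itv/= => /andP[y0 yc].
have zy0 : 0 < z y by rewrite divr_gt0 ?powR_gt0.
have zy1 : z y < 1 by rewrite powR_lt_endE.
have dz : is_derive y 1 z (alpha * z y / y).
  apply: (is_derive_eq (is_derive_mul (f := (@powR R)^~ alpha)
    (is_derive1_powR alpha y0) (is_derive_cst c^-1 y 1))).
  rewrite powRB; last by rewrite (gt_eqF y0) implybT.
  by rewrite powRr1 ?ltW// mulr0 addr0 /z /=; ring.
have w0 : 0 < 1 - z y ^+ 2 by rewrite subr_gt0 expr_lt1// ltW.
pose w y := Num.sqrt (1 - z y ^+ 2).
have wy0 : 0 < w y by rewrite sqrtr_gt0.
have w2 : w y ^+ 2 = 1 - z y ^+ 2 by rewrite sqr_sqrtr// ltW.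
split.
  have zi : -1 < z y < 1 by rewrite zy1 (lt_trans _ zy0)// ltrN10.
  apply: (is_derive_eq (is_derive_mul (is_derive_cst alpha^-1 y 1)
    (is_derive_comp (is_derive1_asin zi) dz))).
  rewrite /= mul0r add0r -/(w y); field.
  by rewrite !gt_eqF.
have dw : is_derive y 1 w (- alpha * z y ^+ 2 / y / w y).
  have d1 := is_derive_add (is_derive_cst (1 : R) y 1)
    (is_deriveN (is_derive_exp 1 dz)).
  apply: (is_derive_eq (is_derive_comp (g := fun y => 1 - z y ^+ 2)
    (is_derive1_sqrt w0) d1)).
  by rewrite add0r expr1 -/(w y); field; rewrite !gt_eqF.
apply: (is_derive_eq (is_derive_mul dz (is_derive_inv (lt0r_neq0 wy0) dw))).
rewrite -/(w y).
have -> : 1 + (z y / w y) ^+ 2 = (w y ^+ 2)^-1.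
  by rewrite -[RHS]mul1r -[in RHS](subrK (z y ^+ 2) 1) -w2; field; rewrite gt_eqF.
rewrite -[RHS]mul1r -[in RHS](subrK (z y ^+ 2) 1) -w2.
by field; rewrite !gt_eqF.
Qed.

End Profiles.

(** * From the first integral to explicit formulas *)

Section Classification.
Variables (R : realType) (alpha : R) (I : set R) (lam : R -> R) (k : R).
Hypotheses (itvI : is_interval I) (I_neq0 : I !=set0).
Hypotheses (I_gt0 : I `<=` [set y | 0 < y]).
Hypothesis dlam : forall y, I y -> derivable lam y 1.
Hypothesis sinelam : forall y, I y -> sine (y * derive1 lam y) = k * y `^ alpha.

Lemma eq_derive_shift (f g df : R -> R) :
  (forall y, I y -> is_derive y 1 f (df y)) ->
  (forall y, I y -> is_derive y 1 g (df y)) ->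
  exists b, forall y, I y -> f y = g y + b.
Proof.
move=> dfE dgE; have [z Iz] := I_neq0; exists (f z - g z) => y Iy.
have <- : f y - g y = f z - g z; last by rewrite addrC subrK.
apply: (is_interval_derive0_cst itvI (f := fun x => f x - g x)) => // x Ix.
apply: (is_derive_eq (is_derive_add (dfE _ Ix) (is_deriveN (dgE _ Ix)))).
by rewrite subrr.
Qed.

Lemma first_integral_lt1 y : I y -> `|k * y `^ alpha| < 1.
Proof. by move=> /sinelam/sine_inv[]. Qed.

Lemma first_integral_is_derive y : I y -> let z := k * y `^ alpha in
  is_derive y 1 lam (z / Num.sqrt (1 - z ^+ 2) / y).
Proof.
move=> Iy z; have [_ ] := sine_inv (sinelam Iy); rewrite -/z => <-.
apply: (is_derive_eq (derive1_is_derive (dlam Iy))).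
by rewrite [y * _]mulrC mulfK// gt_eqF// I_gt0.
Qed.

Lemma first_integral0 : k = 0 -> exists b, forall y, I y -> lam y = b.
Proof.
move=> k0; have [y Iy|b lb] := @eq_derive_shift lam (fun=> 0) (fun=> 0).
- by apply: (is_derive_eq (first_integral_is_derive Iy)); rewrite k0 !mul0r.
- by exists b => y Iy; rewrite lb// add0r.
Qed.

(** Since y^0 = 1, the sine is the constant k, so y lam' is the constant C = k / sqrt(1 - k^2). Its
    sign decides between a translate and a reflection of the profile with c = |C|. *)
Lemma first_integral_ln : alpha = 0 -> k != 0 -> exists2 c, 0 < c &
  exists b, (forall y, I y -> lam y = log_profile c y + b) \/
            (forall y, I y -> lam y = b - log_profile c y).
Proof.
move=> a0 k0; pose C := k / Num.sqrt (1 - k ^+ 2).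
have [z Iz] := I_neq0.
have k1 : `|k| < 1 by have := first_integral_lt1 Iz; rewrite a0 powRr0 mulr1.
have C0 : C != 0.
  rewrite mulf_neq0// invr_neq0// gt_eqF// sqrtr_gt0 subr_gt0.
  by rewrite -real_normK ?num_real// expr_lt1.
have dl y : I y -> is_derive y 1 lam (C / y).
  move=> Iy; apply: (is_derive_eq (first_integral_is_derive Iy)).
  by rewrite a0 powRr0 mulr1.
have dlog c y : I y -> is_derive y 1 (log_profile c) (c / y).
  move=> Iy; apply: (is_derive_eq (is_derive_mul (is_derive_cst c y 1)
    (is_derive1_ln (I_gt0 Iy)))).
  by rewrite mul0r add0r.
exists `|C|; first by rewrite normr_gt0.
have [b lb] := eq_derive_shift dl (dlog C).
exists b; case: (ltrgtP C 0) C0 => // C0 _; [right|left] => y Iy; rewrite lb//.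
  by rewrite /log_profile ltr0_norm// mulNr opprK addrC.
by rewrite gtr0_norm.
Qed.

(** Take c = 1/|k|: the bound |k y^alpha| < 1 then says exactly that y lies below the end of the
    arcsine profile. The sign of k decides between translation and reflection. *)
Lemma first_integral_asin : 0 < alpha -> k != 0 -> exists2 c, 0 < c &
  [/\ I `<=` `]0, c `^ alpha^-1[
    & exists b, (forall y, I y -> lam y = asin_profile alpha c y + b) \/
                (forall y, I y -> lam y = b - asin_profile alpha c y)].
Proof.
move=> a0 k0; pose c := `|k|^-1; have c0 : 0 < c by rewrite invr_gt0 normr_gt0.
have cE : `|k| = c^-1 by rewrite invrK.
have Isub : I `<=` `]0, c `^ alpha^-1[.
  move=> y Iy; have y0 := I_gt0 Iy; rewrite /= in_itv/= y0/=.
  rewrite -powR_lt_endE// mulrC -cE.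
  have := first_integral_lt1 Iy.
  by rewrite normrM [X in _ * X]ger0_norm ?powR_ge0.
exists c => //; split=> //.
have dasin y : I y -> let z := y `^ alpha / c in
    is_derive y 1 (asin_profile alpha c) (z / Num.sqrt (1 - z ^+ 2) / y).
  by move=> /Isub Iy; have [] := solution_asin a0 c0 Iy.
case: (ltrgtP k 0) k0 => // ks _.
  have [y Iy|b lb] := eq_derive_shift (g := fun y => - asin_profile alpha c y)
    first_integral_is_derive.
    apply: (is_derive_eq (is_deriveN (dasin _ Iy))) => /=.
    have -> : k = - c^-1 by rewrite -cE ltr0_norm// opprK.
    by rewrite !mulNr sqrrN [c^-1 * _]mulrC.
  by exists b; right => y Iy; rewrite lb// addrC.
have [y Iy|b lb] := eq_derive_shift (g := asin_profile alpha c)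
  first_integral_is_derive.
  apply: (is_derive_eq (dasin _ Iy)) => /=.
  have -> : k = c^-1 by rewrite -cE gtr0_norm.
  by rewrite [c^-1 * _]mulrC.
by exists b; left.
Qed.

End Classification.

(** * Row vectors *)

Section RowVectors.
Variable R : realType.

Lemma invmx_eq k (A B : 'M[R]_k) : A *m B = 1%:M -> invmx A = B.
Proof.
move=> AB; have [uA _] := mulmx1_unit AB.
by rewrite -[invmx A]mulmx1 -AB mulKmx.
Qed.

Lemma cvg_row T (F : set_system T) {FF : Filter F} N (f : T -> 'rV[R]_N)
    (l : 'rV[R]_N) :
  (forall j, f q 0 j @[q --> F] --> l 0 j) -> f q @[q --> F] --> l.
Proof.
move=> fl A [P nP sPA]; rewrite /nbhs/=.
suff : \forall q \near F, forall j, P 0 j (f q 0 j).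
  by apply: filterS => q Pq; apply: sPA => i j; rewrite ord1.
by apply: filter_forall => j; apply: fl; exact: nP.
Qed.

Lemma is_derive_row (V : normedModType R) N (f : V -> 'rV[R]_N) (p v : V)
    (D : 'rV[R]_N) :
  (forall j, is_derive p v (fun q => f q 0 j) (D 0 j)) -> is_derive p v f D.
Proof.
move=> fD; have df : derivable f p v.
  by apply/derivable_mxP => i j; rewrite ord1; have [] := fD j.
apply: DeriveDef => //; rewrite derive_mx//.
by apply/rowP => j; rewrite mxE; have [_ <-] := fD j.
Qed.

(** Chain rule through the coordinate functional, which is linear and continuous, hence its own
    differential. *)
Lemma is_derive_coord N (f : R -> R) (p v : 'rV[R]_N) j a :
  is_derive (p 0 j) 1 f a ->
  is_derive p v (fun q : 'rV[R]_N => f (q 0 j)) (v 0 j * a).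
Proof.
move=> [df fa]; pose c (q : 'rV[R]_N) : R := q 0 j.
have dc : differentiable c p by exact: differentiable_coord.
have dfc : differentiable f (c p) by exact/derivable1_diffP.
apply: DeriveDef; first exact/diff_derivable/differentiable_comp.
rewrite deriveE; last exact: differentiable_comp.
rewrite (diff_comp dc dfc) /=.
have cl : linear c by move=> x u w; rewrite /c !mxE.
pose L : {linear 'rV[R]_N -> R} := HB.pack c (GRing.isLinear.Build _ _ _ _ c cl).
have -> : 'd c p v = c v.
  by rewrite -[c]/(L : _ -> _) (@diff_lin _ _ _ L)//; exact: coord_continuous.
rewrite -[c v]mulr1 linearZ/=; congr (_ * _).
by rewrite -fa deriveE.
Qed.

End RowVectors.

(** * The metric of H^n x R *)

Section Metric.
Variables (R : realType) (n : nat).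
Local Notation it := (it n).
Local Notation iy := (iy n).
Local Notation last := (@ord_max n.-1).
Local Notation G := (@HnR_metric R n).
Local Notation hpoint := (hpoint R n).
Implicit Types (p u v w : hpoint).

Lemma sum_ambient (F : 'I_n.-1.+2 -> R) :
  \sum_l F l = F it + \sum_(j < n.-1.+1) F (lift it j).
Proof. by rewrite (bigD1_ord it). Qed.

Lemma lift_it_neq j : (lift it j == it) = false.
Proof. by rewrite eq_sym (negPf (neq_lift _ _)). Qed.

Definition hdot u v : R :=
  \sum_(j < n.-1.+1) u 0 (lift it j) * v 0 (lift it j).

Definition gcoef p (l : 'I_n.-1.+2) : R := if l == it then 1 else ycoord p ^- 2.

Lemma gcoef_neq0 p k : 0 < ycoord p -> gcoef p k != 0.
Proof.
move=> y0; rewrite /gcoef; case: ifP => _; rewrite ?oner_neq0//.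
by rewrite invr_neq0// expf_neq0// gt_eqF.
Qed.

Lemma HnR_metricE p : G p = diag_mx (\row_l gcoef p l).
Proof. by []. Qed.

Lemma inner_sum p u v : inner G p u v = \sum_l gcoef p l * (u 0 l * v 0 l).
Proof.
rewrite /inner HnR_metricE mxE; apply: eq_bigr => l _.
by rewrite mul_mx_diag !mxE mulrAC mulrC.
Qed.

Lemma innerE p u v :
  inner G p u v = u 0 it * v 0 it + ycoord p ^- 2 * hdot u v.
Proof.
rewrite inner_sum sum_ambient /gcoef eqxx mul1r mulr_sumr; congr (_ + _).
by apply: eq_bigr => j _; rewrite lift_it_neq.
Qed.

(** The derivative of [gcoef] in y, the only coordinate on which the metric depends. *)
Definition dcoef p (l : 'I_n.-1.+2) : R :=
  if l == it then 0 else - 2 * ycoord p ^- 3.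

Lemma pder_metric p a b l : 0 < ycoord p ->
  pder a (fun q => G q b l) p = (b == l)%:R * (a == iy)%:R * dcoef p b.
Proof.
move=> y0; rewrite /pder /dcoef.
have -> : (fun q => G q b l) = (fun q : hpoint => (b == l)%:R *
    (if b == it then 1 else (q 0 iy) ^- 2)).
  apply/funext => q; rewrite HnR_metricE !mxE /gcoef.
  by case: (b == l); rewrite ?mul1r ?mul0r.
have [bt|bt] := boolP (b == it).
  rewrite mulr0.
  by have [_ ->] := is_derive_cst ((b == l)%:R * 1 : R) p (delta_mx 0 a).
have d2 : is_derive (p 0 iy) 1 (fun y : R => (b == l)%:R * y ^- 2)
    ((b == l)%:R * (- 2 * (p 0 iy) ^- 3)).
  have y20 : p 0 iy ^+ 2 != 0 by rewrite expf_neq0// gt_eqF.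
  have dsqr := is_derive_exp (f := id) 1 (is_derive_id (p 0 iy) 1).
  have dinv := is_derive_inv (f := fun y => y ^+ 2) y20 dsqr.
  have dprod := is_derive_mul (is_derive_cst ((b == l)%:R : R) (p 0 iy) 1) dinv.
  apply: (is_derive_eq dprod).
  by rewrite /= mul0r add0r; field; rewrite gt_eqF.
have [_ ->] := is_derive_coord (delta_mx 0 a) d2.
by rewrite mxE eqxx/= [iy == a]eq_sym mulrCA mulrA.
Qed.

(** The metric is diagonal, so only s = l survives in the defining sum. The Kronecker symbols are
    kept as factors so that later sums collapse by [sum_delta]. *)
Lemma christoffelE p l a b : 0 < ycoord p ->
  christoffel G l a b p = 2^-1 * (gcoef p l)^-1 *
    ((a == iy)%:R * (b == l)%:R * dcoef p l
     + (b == iy)%:R * (a == l)%:R * dcoef p l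
     - (l == iy)%:R * (a == b)%:R * dcoef p a).
Proof.
move=> y0; have g0 k := gcoef_neq0 k y0.
have iG : invmx (G p) = diag_mx (\row_k (gcoef p k)^-1).
  apply: invmx_eq; rewrite HnR_metricE mulmx_diag -diag_const_mx; congr diag_mx.
  by apply/rowP => k; rewrite !mxE divff.
rewrite /christoffel -mulrA; congr (_ * _).
rewrite (bigD1 l)//= big1 ?addr0; last first.
  by move=> k kl; rewrite iG !mxE eq_sym (negPf kl) mulr0n mul0r.
rewrite iG !mxE eqxx mulr1n; congr (_ * _).
rewrite !pder_metric//; congr (_ + _ - _).
- rewrite [X in X * _]mulrC; have [->//|_] := eqVneq b l.
  by rewrite !mulr0 !mul0r.
- rewrite [X in X * _]mulrC; have [->//|_] := eqVneq a l.
  by rewrite !mulr0 !mul0r.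
- by rewrite [X in X * _]mulrC.
Qed.

Definition connection p u v : hpoint :=
  \row_l \sum_a \sum_b christoffel G l a b p * u 0 a * v 0 b.

Lemma sum_delta N (F : 'I_N -> R) k : \sum_i (i == k)%:R * F i = F k.
Proof.
rewrite (bigD1 k)//= eqxx mul1r big1 ?addr0// => i /negPf ->.
by rewrite mul0r.
Qed.

(** Pairing with [w] cancels the inverse metric coefficient of the Christoffel symbols and leaves
    only [dcoef]. As [dcoef] vanishes at the index of t, only the Euclidean products of the
    components along H^n remain. *)
Lemma inner_connection p u v w : 0 < ycoord p ->
  inner G p (connection p u v) w = - ycoord p ^- 3 *
    (ycoord u * hdot v w + ycoord v * hdot u w - ycoord w * hdot u v).
Proof.
move=> y0; have g0 k := gcoef_neq0 k y0.
have dsum (x z : hpoint) : \sum_l dcoef p l * (x 0 l * z 0 l) =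
    - 2 * ycoord p ^- 3 * hdot x z.
  rewrite sum_ambient /dcoef eqxx mul0r add0r mulr_sumr; apply: eq_bigr => j _.
  by rewrite lift_it_neq.
have inn l : \sum_a \sum_b christoffel G l a b p * u 0 a * v 0 b =
    2^-1 * (gcoef p l)^-1 * (ycoord u * (dcoef p l * v 0 l)
     + ycoord v * (dcoef p l * u 0 l)
     - (l == iy)%:R * \sum_a dcoef p a * (u 0 a * v 0 a)).
  (* Each Kronecker symbol is moved in front of the sum over its index, ready for [sum_delta]. *)
  transitivity (2^-1 * (gcoef p l)^-1 *
    (\sum_a (a == iy)%:R * (u 0 a * (\sum_b (b == l)%:R * (dcoef p l * v 0 b)))
     + \sum_a (a == l)%:R * (u 0 a * (\sum_b (b == iy)%:R * (dcoef p l * v 0 b)))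
     - (l == iy)%:R * \sum_a \sum_b (b == a)%:R * (dcoef p a * (u 0 a * v 0 b)))).
    rewrite mulr_sumr -!big_split/= -sumrB mulr_sumr; apply: eq_bigr => a _.
    rewrite !mulr_sumr -!big_split/= -sumrB mulr_sumr; apply: eq_bigr => b _.
    by rewrite christoffelE// [b == a]eq_sym; ring.
  rewrite !sum_delta; congr (_ * (_ + _ - _ * _)).
    by rewrite /ycoord; ring.
  by apply: eq_bigr => a _; rewrite sum_delta.
rewrite inner_sum.
transitivity (2^-1 * (\sum_l (ycoord u * (dcoef p l * (v 0 l * w 0 l))
   + ycoord v * (dcoef p l * (u 0 l * w 0 l)))
   - \sum_l (l == iy)%:R * (w 0 l * \sum_a dcoef p a * (u 0 a * v 0 a)))).
  rewrite -sumrB mulr_sumr; apply: eq_bigr => l _.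
  rewrite mxE inn; field; exact: g0.
rewrite sum_delta big_split/= -!mulr_sumr !dsum.
by rewrite /ycoord; field; rewrite gt_eqF.
Qed.

End Metric.

(** * Hypersurfaces swept out by parabolic translations: first and second derivatives *)

Section ProfileMap.
Variables (R : realType) (n : nat).
Local Notation it := (it n).
Local Notation iy := (iy n).
Local Notation last := (@ord_max n.-1).
Local Notation G := (@HnR_metric R n).
Local Notation hpoint := (hpoint R n).
Local Notation chart := (chart R n).

(* [lift it] enumerates the coordinates other than t, and sends the last index
   to that of y. *)
Definition hrow (t : R) (x : 'I_n.-1.+1 -> R) : hpoint :=
  \row_l (if unlift it l is Some i then x i else t).

Lemma hrow_it t x : hrow t x 0 it = t.
Proof. by rewrite mxE unlift_none. Qed.

Lemma hrow_lift t x i : hrow t x 0 (lift it i) = x i.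
Proof. by rewrite mxE liftK. Qed.

Lemma hrow_y t x : ycoord (hrow t x) = x last.
Proof. exact: hrow_lift. Qed.

Lemma hrowP (p : hpoint) t x :
  p 0 it = t -> (forall i, p 0 (lift it i) = x i) -> p = hrow t x.
Proof.
move=> pt px; apply/rowP => l; rewrite mxE; case: unliftP => [i ->|->//].
exact: px.
Qed.

(** The last chart coordinate is the parameter of the generating curve (Y, T); the others are the
    x-coordinates. Both kinds of graph in the theorem are instances. *)
Definition profile_map (Y T : R -> R) (q : chart) : hpoint :=
  hrow (T (q 0 last)) (fun i => if i == last then Y (q 0 last) else q 0 i).

Definition tangent (y1 t1 : R) (j : 'I_n.-1.+1) : hpoint :=
  hrow ((j == last)%:R * t1)
       (fun i => (i == j)%:R * (if j == last then y1 else 1)).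

(** The map is affine in the x-coordinates, with Y and T depending on the last one alone, so only
    the pure second derivative in the last coordinate can be nonzero. *)
Definition accel (y2 t2 : R) (i j : 'I_n.-1.+1) : hpoint :=
  hrow (((i == last) && (j == last))%:R * t2)
       (fun k => ((i == last) && (j == last))%:R * (k == last)%:R * y2).

Section Derivatives.
Variables (I : set R) (Y T : R -> R).
Hypotheses (oI : open I) (C2Y : C2_real I Y) (C2T : C2_real I T).
Let phi := profile_map Y T.

Lemma strip_open : open (strip (n := n) I).
Proof.
have c : continuous (@hyp_y R n) by exact: coord_continuous.
by move/continuousP : c; exact.
Qed.

Lemma is_derive_profile_map p j : strip I p ->
  is_derive p (delta_mx 0 j) phi
    (tangent (derive1 Y (p 0 last)) (derive1 T (p 0 last)) j).
Proof.
move=> Ip; have [dY _ _] := C2Y Ip; have [dT _ _] := C2T Ip.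
apply: is_derive_row => l; have [i ->|->] := unliftP it l.
  rewrite hrow_lift.
  have -> : (fun q : chart => phi q 0 (lift it i)) =
      (fun q => (if i == last then Y else id) (q 0 i)).
    by apply/funext => q; rewrite hrow_lift; case: eqP => [->|].
  have [->|il] := eqVneq i last.
    apply: (is_derive_eq (is_derive_coord _ (derive1_is_derive dY))).
    by rewrite mxE eqxx/= eq_sym; case: eqP => _; rewrite ?mul1r ?mul0r.
  apply: (is_derive_eq (is_derive_coord _ (is_derive_id (p 0 i) 1))).
  rewrite mxE eqxx/= mulr1; case: eqP => [ij|]; last by rewrite mul0r.
  by rewrite -ij (negPf il) mul1r.
rewrite hrow_it.
have -> : (fun q : chart => phi q 0 it) = (fun q => T (q 0 last)).
  by apply/funext => q; rewrite hrow_it.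
apply: (is_derive_eq (is_derive_coord _ (derive1_is_derive dT))).
by rewrite mxE eqxx/= eq_sym.
Qed.

Lemma pder_profile_map p j : strip I p ->
  pder j phi p = tangent (derive1 Y (p 0 last)) (derive1 T (p 0 last)) j.
Proof. by move=> Ip; have [] := @is_derive_profile_map p j Ip. Qed.

Lemma near_strip p : strip (n := n) I p -> \forall q \near p, strip I q.
Proof. by move=> Ip; apply: open_nbhs_nbhs; split => //; exact: strip_open. Qed.

Lemma is_derive_tangent p i j : strip I p ->
  is_derive p (delta_mx 0 i) (pder j phi)
    (accel (derive1n 2 Y (p 0 last)) (derive1n 2 T (p 0 last)) i j).
Proof.
move=> Ip; have [_ dY _] := C2Y Ip; have [_ dT _] := C2T Ip.
apply: (@near_eq_is_derive _ _ _ (fun q : chart =>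
    tangent (derive1 Y (q 0 last)) (derive1 T (q 0 last)) j)).
  by near=> q; rewrite pder_profile_map//; near: q; exact: near_strip.
apply: is_derive_row => l; have [k ->|->] := unliftP it l.
  rewrite hrow_lift.
  have -> : (fun q : chart => tangent (derive1 Y (q 0 last))
      (derive1 T (q 0 last)) j 0 (lift it k)) = (fun q =>
      (fun s => (k == j)%:R * (if j == last then derive1 Y s else 1)) (q 0 last)).
    by apply/funext => q; rewrite hrow_lift.
  have d : is_derive (p 0 last) 1
      (fun s => (k == j)%:R * (if j == last then derive1 Y s else 1))
      ((k == j)%:R * (j == last)%:R * derive1n 2 Y (p 0 last)).
    have [jl|jl] := eqVneq j last.
      apply: (is_derive_eq (is_derive_mul
        (is_derive_cst ((k == j)%:R : R) (p 0 last) 1) (derive1_is_derive dY))).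
      by rewrite mul0r add0r mulr1.
    by apply: (is_derive_eq (is_derive_cst ((k == j)%:R * 1 : R) (p 0 last) 1));
      rewrite mulr0 mul0r.
  apply: (is_derive_eq (is_derive_coord _ d)).
  rewrite mxE eqxx/= [last == i]eq_sym.
  have [->|] := eqVneq j last; last by rewrite andbF !(mulr0, mul0r).
  by rewrite mulr1 andbT mulrA.
rewrite hrow_it.
have -> : (fun q : chart => tangent (derive1 Y (q 0 last))
    (derive1 T (q 0 last)) j 0 it) = (fun q =>
    (fun s => (j == last)%:R * derive1 T s) (q 0 last)).
  by apply/funext => q; rewrite hrow_it.
apply: (is_derive_eq (is_derive_coord _ (is_derive_mul
  (is_derive_cst ((j == last)%:R : R) (p 0 last) 1) (derive1_is_derive dT)))).
by rewrite mul0r add0r mxE eqxx/= [last == i]eq_sym mulrA -natrM mulnb.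
Unshelve. all: by end_near. Qed.

Lemma pder2_profile_map p i j : strip I p -> pder i (pder j phi) p =
  accel (derive1n 2 Y (p 0 last)) (derive1n 2 T (p 0 last)) i j.
Proof. by move=> Ip; have [] := @is_derive_tangent p i j Ip. Qed.

Lemma continuous_hrow (t : chart -> R) (x : 'I_n.-1.+1 -> chart -> R) p :
  {for p, continuous t} -> (forall i, {for p, continuous (x i)}) ->
  {for p, continuous (fun q => hrow (t q) (x^~ q))}.
Proof.
move=> ct cx; apply: (@cvg_row _ _ (nbhs p) (nbhs_filter p)) => l.
have [i ->|->] := unliftP it l.
  rewrite hrow_lift (_ : (fun q => _) = x i); first exact: cx.
  by apply/funext => q; rewrite hrow_lift.
rewrite hrow_it (_ : (fun q => _) = t)//.
by apply/funext => q; rewrite hrow_it.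
Qed.

Lemma continuous_comp_last (f : R -> R) (p : chart) :
  {for p 0 last, continuous f} ->
  {for p, continuous (fun q : chart => f (q 0 last))}.
Proof.
move=> cf; apply: (@continuous_comp _ _ _ (fun q : chart => q 0 last) f) => //.
exact: coord_continuous.
Qed.

Lemma continuous_scale_last (a : R) (f : R -> R) (p : chart) :
  {for p 0 last, continuous f} ->
  {for p, continuous (fun q : chart => a * f (q 0 last))}.
Proof.
move=> cf; apply: continuousM; first exact: cst_continuous.
exact: continuous_comp_last.
Qed.

Lemma C2_profile_map : C2_on (strip I) phi.
Proof.
have cont (f g : chart -> hpoint) p : strip I p ->
    (forall q, strip I q -> f q = g q) -> {for p, continuous g} ->
    {for p, continuous f}.
  move=> Ip fg cg; have fgp := fg _ Ip.
  suff : f q @[q --> p] --> f p by [].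
  rewrite fgp; apply: cvg_trans cg.
  apply: (@near_eq_cvg _ _ (nbhs p) (nbhs_filter p)).
  by apply: filterS (near_strip Ip) => q Iq; rewrite fg.
have der1 (f : R -> R) (s : R) : derivable f s 1 -> {for s, continuous f}.
  by move=> df; exact: is_derive_continuous (derive1_is_derive df).
split=> [p j Ip|j p i Ip].
  split; first by have [] := @is_derive_profile_map p j Ip.
  apply: (cont _ _ _ Ip (fun q => @pder_profile_map q j)).
  have [_ /der1 cY _] := C2Y Ip; have [_ /der1 cT _] := C2T Ip.
  apply: continuous_hrow => [|i].
    exact: continuous_scale_last cT.
  case: (j == last); last exact: cst_continuous.
  exact: continuous_scale_last cY.
split; first by have [] := @is_derive_tangent p i j Ip.
apply: (cont _ _ _ Ip (fun q => @pder2_profile_map q i j)).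
have [_ _ cY] := C2Y Ip; have [_ _ cT] := C2T Ip.
apply: continuous_hrow => [|k].
  exact: continuous_scale_last cT.
exact: continuous_scale_last cY.
Qed.

End Derivatives.
End ProfileMap.

(** * Curvature of a hypersurface invariant by parabolic translations *)

Section Curvature.
Variables (R : realType) (n : nat).
Local Notation it := (it n).
Local Notation iy := (iy n).
Local Notation last := (@ord_max n.-1).
Local Notation G := (@HnR_metric R n).
Local Notation hpoint := (hpoint R n).
Local Notation chart := (chart R n).
Variables (I : set R) (Y T : R -> R).
Hypotheses (oI : open I) (C2Y : C2_real I Y) (C2T : C2_real I T).
Let phi : chart -> hpoint := profile_map Y T.

Lemma hdot_tangent y1 t1 j (w : hpoint) :
  hdot (tangent y1 t1 j) w = (if j == last then y1 else 1) * w 0 (lift it j).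
Proof.
rewrite /hdot; under eq_bigr do rewrite hrow_lift -mulrA.
by rewrite sum_delta.
Qed.

Section AtPoint.
Variables (p : chart).
Hypothesis Ip : strip I p.
Let s0 : R := p 0 last.
Let y : R := Y s0.
Let y1 : R := derive1 Y s0.
Let y2 : R := derive1n 2 Y s0.
Let t1 : R := derive1 T s0.
Let t2 : R := derive1n 2 T s0.
Hypothesis y_gt0 : 0 < y.
Hypothesis regular : 0 < y1 ^+ 2 + y ^+ 2 * t1 ^+ 2.

Lemma ycoord_profile_map : ycoord (phi p) = y.
Proof. by rewrite hrow_y eqxx. Qed.

Let fcoef (i : 'I_n.-1.+1) : R :=
  if i == last then t1 ^+ 2 + y ^- 2 * y1 ^+ 2 else y ^- 2.

Lemma fcoef_neq0 i : fcoef i != 0.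
Proof.
rewrite /fcoef; case: ifP => _; last by rewrite invr_neq0// expf_neq0// gt_eqF.
have -> : t1 ^+ 2 + y ^- 2 * y1 ^+ 2 = (y1 ^+ 2 + y ^+ 2 * t1 ^+ 2) / y ^+ 2.
  by field; rewrite gt_eqF.
by rewrite mulf_neq0 ?gt_eqF// invr_gt0 exprn_gt0.
Qed.

Lemma first_formE : first_form G phi p = diag_mx (\row_i fcoef i).
Proof.
apply/matrixP => i j; rewrite !mxE !(pder_profile_map C2Y C2T)//.
rewrite innerE ycoord_profile_map hdot_tangent !hrow_it hrow_lift -/s0 -/y1 -/t1.
have [->|ij] := eqVneq i j.
  rewrite mul1r mulr1n /fcoef; case: ifP => _; rewrite ?mul1r ?mul0r ?expr2//.
  by rewrite mulr1 add0r.
rewrite mulr0n mul0r mulr0 mulr0 addr0.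
have [il|_] := eqVneq i last; last by rewrite !mul0r.
by rewrite -il eq_sym (negPf ij) mul0r mulr0.
Qed.

(** The first form is A G A^T for the matrix A of tangent vectors. Being diagonal with nonzero
    entries it is invertible, which exhibits a right inverse of A. *)
Lemma row_free_tangents : row_free (\matrix_i pder i phi p).
Proof.
set A := \matrix_i _; have FA : first_form G phi p = A *m G (phi p) *m A^T.
  apply/matrixP => i j; rewrite /inner [LHS]mxE [RHS]mxE [LHS]mxE.
  apply: eq_bigr => l _; rewrite [X in _ = _ * X]mxE [X in _ = _ * X]mxE.
  rewrite [X in X * _ = _]mxE [X in _ = X * _]mxE [X in _ * X = _]mxE.
  by congr (_ * _); apply: eq_bigr => k _; rewrite [X in _ = X * _]mxE.
apply/row_freeP; exists (G (phi p) *m A^T *m diag_mx (\row_i (fcoef i)^-1)).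
rewrite !mulmxA -FA first_formE mulmx_diag -diag_const_mx; congr diag_mx.
by apply/rowP => i; rewrite !mxE divff// fcoef_neq0.
Qed.

Variable nu : hpoint.
Hypothesis unu : unit_normal G phi p nu.

Lemma normal_x j : j != last -> nu 0 (lift it j) = 0.
Proof.
move=> jl; have := unu.2 j; rewrite (pder_profile_map C2Y C2T)// innerE.
rewrite ycoord_profile_map hdot_tangent hrow_it (negPf jl) !mul0r mul1r add0r.
by move/eqP; rewrite mulf_eq0 invr_eq0 expf_eq0/= gt_eqF//= => /eqP.
Qed.

Lemma normal_last : t1 * nu 0 it + y ^- 2 * y1 * nu 0 iy = 0.
Proof.
have := unu.2 last; rewrite (pder_profile_map C2Y C2T)// innerE.
by rewrite ycoord_profile_map hdot_tangent hrow_it eqxx !mul1r mulrA.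
Qed.

Lemma normal_norm : nu 0 it ^+ 2 + y ^- 2 * nu 0 iy ^+ 2 = 1.
Proof.
have := unu.1; rewrite innerE ycoord_profile_map /hdot (bigD1 last)//= big1.
  by rewrite addr0 -!expr2.
by move=> j jl; rewrite normal_x// mul0r.
Qed.

(** These are the principal curvatures: [kx] in each direction of parabolic translation, [ky] along
    the generating curve. *)
Let kx : R := nu 0 iy / y.
Let ky : R :=
  (y ^- 2 * y2 * nu 0 iy + t2 * nu 0 it - y ^- 3 * y1 ^+ 2 * nu 0 iy) /
  (t1 ^+ 2 + y ^- 2 * y1 ^+ 2).

Lemma second_formE : second_form G phi nu p =
  diag_mx (\row_i ((if i == last then ky else kx) * fcoef i)).
Proof.
apply/matrixP => i j; rewrite !mxE /cov_der.
rewrite !(pder_profile_map C2Y C2T)// (pder2_profile_map oI C2Y C2T)//.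
rewrite -/s0 -/y1 -/t1 -/y2 -/t2.
set Z := \row_l _.
have -> : Z = connection (phi p) (tangent y1 t1 i) (tangent y1 t1 j) by [].
rewrite {Z} /inner mulmxDl mulmxDl mxE -!/(inner _ _ _ _).
rewrite inner_connection ?ycoord_profile_map// innerE ycoord_profile_map.
rewrite !hdot_tangent !hrow_it !hrow_y hrow_lift /fcoef.
have -> : hdot (accel y2 t2 i j) nu =
    ((i == last) && (j == last))%:R * y2 * nu 0 iy.
  rewrite /hdot (bigD1 last)//= big1 ?addr0 => [|k kl]; last first.
    by rewrite normal_x// mulr0.
  by rewrite hrow_lift eqxx mulr1.
have f0 : t1 ^+ 2 + y ^- 2 * y1 ^+ 2 != 0.
  by have := fcoef_neq0 last; rewrite /fcoef eqxx.
rewrite ![last == _]eq_sym /ky /kx /ycoord.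
have [->|il] := eqVneq i last; have [->|jl] := eqVneq j last.
- by rewrite /= divfK// mulr1n -[lift it last]/iy; ring.
- by rewrite /= (normal_x jl) ?mulr0n; ring.
- by rewrite /= (normal_x il) (negPf il) ?mulr0n; ring.
rewrite /=; have [_|_] := eqVneq i j; last by rewrite /= mulr0n; ring.
by rewrite mulr1n /=; field; rewrite gt_eqF.
Qed.

Lemma char_poly_shape : char_poly (shape_operator G phi nu p) =
  \prod_i ('X - (if i == last then ky else kx)%:P).
Proof.
rewrite /shape_operator first_formE second_formE.
rewrite (invmx_eq (B := diag_mx (\row_i (fcoef i)^-1))); last first.
  rewrite mulmx_diag -diag_const_mx; congr diag_mx.
  by apply/rowP => i; rewrite !mxE divff// fcoef_neq0.
rewrite mulmx_diag char_poly_trig ?diag_mx_is_trig//.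
apply: eq_bigr => i _; rewrite !mxE eqxx mulr1n.
by rewrite [_ * fcoef i]mulrC mulKf// fcoef_neq0.
Qed.

(** The characteristic polynomial fixes the curvatures up to order, so the existential can be tested
    on the explicit list. *)
Lemma mean_curvature_eq0P s : (s <= n.-1)%N ->
  (exists2 kap, principal_curvatures G phi nu p kap
              & mean_curvature s.+1 kap = 0) <->
  kx ^+ s * ((n.-1 - s)%:R * kx + s.+1%:R * ky) = 0.
Proof.
move=> sn; rewrite -mean_curvature_split_eq0//; split=> [[kap]|k0].
  rewrite /principal_curvatures char_poly_shape.
  by move=> /(mean_curvature_eq s.+1) <-.
by eexists; [exact: char_poly_shape|exact: k0].
Qed.

(* H_r = 0 for r = s + 1, up to a nonzero factor, in terms of the 2-jet of the
   generating curve (Y, T). *)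
Definition profile_eq s (y y1 y2 t1 t2 : R) : Prop :=
  (y * t1) ^+ s *
  (s.+1%:R * (y1 * t2 - t1 * (y2 - y1 ^+ 2 / y))
   - (n.-1 - s)%:R * (y * t1) * (y1 ^+ 2 / y ^+ 2 + t1 ^+ 2)) = 0.

(** Orthogonality to the generating curve forces the components of [nu] along y and t to be tau (-
    y^2 T') and tau Y', with tau nonzero because [nu] is a unit vector. Both curvatures then carry
    the factor tau up to sign, so the resulting equation no longer involves the normal. *)
Lemma profile_eqP s : (s <= n.-1)%N ->
  (exists2 kap, principal_curvatures G phi nu p kap
              & mean_curvature s.+1 kap = 0) <-> profile_eq s y y1 y2 t1 t2.
Proof.
move=> sn; rewrite mean_curvature_eq0P//.
have y0 : y != 0 by rewrite gt_eqF.
pose w := y1 ^+ 2 + y ^+ 2 * t1 ^+ 2; have w0 : w != 0 by rewrite gt_eqF.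
(* This is the proportionality factor between [nu] and the vector with components - y^2 T' along y
   and Y' along t, isolated by means of w = Y'^2 + y^2 T'^2. *)
pose tau := (y1 * nu 0 it - t1 * nu 0 iy) / w.
have nl : y1 * nu 0 iy = - y ^+ 2 * t1 * nu 0 it.
  have := normal_last => /(congr1 (fun x => y ^+ 2 * x)).
  rewrite mulr0 mulrDr !mulrA divff ?expf_neq0// mul1r addrC => /eqP.
  by rewrite addr_eq0 => /eqP ->; ring.
have nuy : nu 0 iy = - y ^+ 2 * t1 * tau.
  have -> : nu 0 iy = (y1 * (y1 * nu 0 iy) + y ^+ 2 * t1 ^+ 2 * nu 0 iy) / w.
    by rewrite -[LHS](mulfK w0); congr (_ / _); rewrite /w; ring.
  by rewrite nl /tau; field.
have nut : nu 0 it = y1 * tau.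
  have -> : nu 0 it = (y1 ^+ 2 * nu 0 it - t1 * (- y ^+ 2 * t1 * nu 0 it)) / w.
    by rewrite -[LHS](mulfK w0); congr (_ / _); rewrite /w; ring.
  by rewrite -nl /tau; field.
have tau0 : tau != 0.
  apply/eqP => t0; have := normal_norm; rewrite nuy nut t0 !mulr0 expr0n/=.
  by rewrite mulr0 addr0 => /eqP; rewrite eq_sym oner_eq0.
have d0 : t1 ^+ 2 + y ^- 2 * y1 ^+ 2 != 0.
  by have := fcoef_neq0 last; rewrite /fcoef eqxx.
have d0' : y1 ^+ 2 / y ^+ 2 + t1 ^+ 2 != 0 by rewrite addrC mulrC.
have -> : kx = - tau * (y * t1) by rewrite /kx nuy; field.
have -> : ky = tau * (y1 * t2 - t1 * (y2 - y1 ^+ 2 / y)) /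
    (y1 ^+ 2 / y ^+ 2 + t1 ^+ 2).
  rewrite /ky nuy nut; rewrite [y1 ^+ 2 / y ^+ 2]mulrC [X in _ / X = _]addrC.
  congr (_ / _); field; exact: y0.
set A := _ - t1 * _; set D := _ + t1 ^+ 2.
have -> : (- tau * (y * t1)) ^+ s *
   ((n.-1 - s)%:R * (- tau * (y * t1)) + s.+1%:R * (tau * A / D)) =
   (- tau) ^+ s * tau / D * ((y * t1) ^+ s *
     (s.+1%:R * A - (n.-1 - s)%:R * (y * t1) * D)).
  by rewrite exprMn; field.
have P0 : (- tau) ^+ s * tau / D != 0.
  apply: mulf_neq0; last exact: invr_neq0.
  by apply: mulf_neq0 => //; rewrite expf_neq0// oppr_eq0.
rewrite /profile_eq; split=> [/eqP|->]; last by rewrite mulr0.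
by rewrite mulf_eq0 (negPf P0) => /eqP.
Qed.

End AtPoint.

Hypothesis Y_gt0 : forall s, I s -> 0 < Y s.
Hypothesis regular : forall s, I s ->
  0 < derive1 Y s ^+ 2 + Y s ^+ 2 * derive1 T s ^+ 2.

(** The choice tau = 1/w, where w is now the square root; it provides the continuous normal field
    required by [Hr_zero]. *)
Definition profile_normal (q : chart) : hpoint :=
  let s := q 0 last in
  let w := Num.sqrt (derive1 Y s ^+ 2 + Y s ^+ 2 * derive1 T s ^+ 2) in
  hrow (derive1 Y s / w)
       (fun k => (k == last)%:R * (- Y s ^+ 2 * derive1 T s / w)).

Lemma profile_normal_unit p : strip I p ->
  unit_normal G phi p (profile_normal p).
Proof.
move=> Ip; have y0 := Y_gt0 Ip; have w0 := regular Ip.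
rewrite /profile_normal -/(hyp_y p).
set w := Num.sqrt _; have w2 : w ^+ 2 = derive1 Y (hyp_y p) ^+ 2 +
  Y (hyp_y p) ^+ 2 * derive1 T (hyp_y p) ^+ 2 by rewrite sqr_sqrtr// ltW.
have wn0 : w != 0 by rewrite gt_eqF// sqrtr_gt0.
have yn0 : Y (hyp_y p) != 0 by rewrite gt_eqF.
split.
  rewrite innerE hrow_it hrow_y eqxx /hdot (bigD1 last)//= big1 => [|j jl].
    rewrite hrow_lift eqxx addr0 !mul1r.
    transitivity ((derive1 Y (hyp_y p) ^+ 2 +
      Y (hyp_y p) ^+ 2 * derive1 T (hyp_y p) ^+ 2) / w ^+ 2).
      by field; rewrite wn0 yn0.
    by rewrite -w2 divff// expf_neq0.
  by rewrite hrow_lift (negPf jl) !mul0r.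
move=> i; rewrite (pder_profile_map C2Y C2T)// innerE hdot_tangent.
rewrite !hrow_it hrow_y eqxx hrow_lift -/(hyp_y p).
have [_|_] := eqVneq i last; rewrite /= ?mul1r ?mul0r ?mulr0 ?addr0//.
by field; rewrite wn0 yn0.
Qed.

Lemma profile_normal_continuous p : strip I p ->
  {for p, continuous profile_normal}.
Proof.
move=> Ip; have [dY dY1 _] := C2Y Ip; have [_ dT1 _] := C2T Ip.
have cY := is_derive_continuous (derive1_is_derive dY).
have cY1 := is_derive_continuous (derive1_is_derive dY1).
have cT1 := is_derive_continuous (derive1_is_derive dT1).
have c2 (f : R -> R) (s : R) : {for s, continuous f} ->
    {for s, continuous (fun z => f z ^+ 2)}.
  by move=> cf; apply: (continuousM cf cf).
have cw : {for hyp_y p, continuous (fun s =>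
    (Num.sqrt (derive1 Y s ^+ 2 + Y s ^+ 2 * derive1 T s ^+ 2))^-1)}.
  apply: continuousV; first by rewrite gt_eqF// sqrtr_gt0 regular.
  apply: (@continuous_comp _ _ _ (fun s =>
    derive1 Y s ^+ 2 + Y s ^+ 2 * derive1 T s ^+ 2) Num.sqrt); last first.
    exact: sqrt_continuous.
  exact: (continuousD (c2 _ _ cY1) (continuousM (c2 _ _ cY) (c2 _ _ cT1))).
apply: continuous_hrow => [|k].
  exact: (continuous_comp_last (continuousM cY1 cw)).
have cN := continuousM (continuousM (continuousN (c2 _ _ cY)) cT1) cw.
exact: (continuous_scale_last cN).
Qed.

(** Since [profile_eqP] holds for every unit normal, any field witnessing [Hr_zero] yields the
    equation; conversely [profile_normal] serves as the witness. *)
Lemma Hr_zero_profile s : (s <= n.-1)%N ->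
  Hr_zero G phi (@HnR R n) s.+1 (strip I) <->
  forall z, I z -> profile_eq s (Y z) (derive1 Y z) (derive1n 2 Y z)
                     (derive1 T z) (derive1n 2 T z).
Proof.
move=> sn; split=> [[_ _ _ [nu nuP]] z Iz|E].
  pose p : chart := \row__ z; have pz : p 0 last = z by rewrite mxE.
  have Ip : strip I p by rewrite /strip/= /hyp_y pz.
  have [_ unu kap] := nuP _ Ip; rewrite -pz.
  apply/(profile_eqP Ip _ _ unu) => //; first exact: Y_gt0.
  exact: regular.
split; [exact: strip_open|exact: C2_profile_map|move=> p Ip|].
  split; last by apply: row_free_tangents => //; [exact: Y_gt0|exact: regular].
  by rewrite /HnR/= hrow_y eqxx; exact: Y_gt0.
exists profile_normal => p Ip; split.
- exact: profile_normal_continuous.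
- exact: profile_normal_unit.
- apply/(profile_eqP Ip _ _ (profile_normal_unit Ip)) => //.
  + exact: Y_gt0.
  + exact: regular.
  + exact: E.
Qed.

End Curvature.

(** * Maximal vertical graphs *)

Section GraphMaps.
Variables (R : realType) (n : nat).
Local Notation it := (it n).
Local Notation iy := (iy n).
Local Notation last := (@ord_max n.-1).

(** The indices of y and t are the last two, so removing either one leaves the x-indices in
    place. *)
Lemma lift_itE i : i != last -> lift it i = lift iy i.
Proof.
move=> il; apply: val_inj; rewrite /= /bump.
have lti : (i < n.-1)%N.
  by have := ltn_ord i; rewrite ltnS leq_eqVlt => /orP[il'|//]; case/negP: il.
by rewrite ltnn add0n [(n.-1 <= i)%N]leqNgt lti ltnNge (ltnW lti).
Qed.

Lemma lift_iy_last : lift iy last = it.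
Proof.
by apply: val_inj; rewrite /= /bump ltnn leqnn.
Qed.

Lemma graph_map_t (lam : R -> R) :
  graph_map it (lam \o @hyp_y R n) = profile_map id lam.
Proof.
apply/funext => q; apply: hrowP => [|i]; first by rewrite mxE unlift_none.
by rewrite mxE liftK; case: eqP => [->|].
Qed.

Lemma graph_map_y (g : R -> R) :
  graph_map iy (g \o @hyp_y R n) = profile_map g id.
Proof.
apply/funext => q; apply: hrowP => [|i].
  by rewrite mxE -[X in unlift _ X]lift_iy_last liftK.
rewrite mxE; have [->|il] := eqVneq i last; first by rewrite unlift_none.
by rewrite lift_itE// liftK.
Qed.

Lemma C2_real_id (I : set R) : C2_real I id.
Proof.
have d1 : derive1 (id : R -> R) = fun=> 1.
  by apply/funext => y; exact: is_derive_derive1 (is_derive_id y 1).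
have d2 : derive1n 2 (id : R -> R) = fun=> 0.
  apply/funext => y; rewrite /derive1n/= d1.
  exact: is_derive_derive1 (is_derive_cst (1 : R) y 1).
move=> y _; split.
- by have [] := is_derive_id y (1 : R).
- by rewrite d1; have [] := is_derive_cst (1 : R) y 1.
- by rewrite d2; exact: cst_continuous.
Qed.

Lemma derive1_id (y : R) : derive1 (id : R -> R) y = 1.
Proof. exact: is_derive_derive1 (is_derive_id y 1). Qed.

Lemma derive2_id (y : R) : derive1n 2 (id : R -> R) y = 0.
Proof.
apply: is_derive_derive1; apply: (@is_derive_near _ (fun=> 1)).
  by near=> z; rewrite derive1_id.
Unshelve. all: by end_near. Qed.

End GraphMaps.

(** * Vertical graphs with H_r = 0 as solutions of an ordinary differential equation *)

Section ParabolicSolutions.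
Variables (R : realType) (n s : nat).
Hypothesis (n_gt0 : (0 < n)%N) (sn : (s < n)%N).
Let alpha := arcsin_exponent R n s.+1.

Let sn1 : (s <= n.-1)%N.
Proof. by rewrite -ltnS prednK. Qed.

Lemma arcsin_exponentE : (n.-1 - s)%:R = s.+1%:R * alpha.
Proof.
rewrite /alpha /arcsin_exponent mulrC divfK ?pnatr_eq0//.
by rewrite -natrB// -{2}(prednK n_gt0) subSS.
Qed.

Lemma parabolic_solutionP (I : set R) lam : parabolic_solution n s.+1 I lam <->
  [/\ open I, is_interval I, I !=set0, I `<=` [set y | 0 < y]
    & C2_real I lam /\ forall y, I y ->
        radial_eq alpha s y (derive1 lam y) (derive1n 2 lam y)].
Proof.
have eqE (y : R) t1 t2 : 0 < y ->
    profile_eq n s y 1 0 t1 t2 <-> radial_eq alpha s y t1 t2.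
  move=> y0; rewrite /profile_eq arcsin_exponentE.
  set P := (X in X = 0 <-> _).
  have -> : P = - s.+1%:R / y ^+ 2 * ((y * t1) ^+ s *
      (alpha * (y * t1) * (1 + (y * t1) ^+ 2) - y * (t1 + y * t2))).
    by rewrite /P; field; rewrite gt_eqF.
  have s0 : - s.+1%:R / y ^+ 2 != 0.
    by rewrite mulf_neq0 ?oppr_eq0 ?pnatr_eq0// invr_neq0// expf_neq0// gt_eqF.
  split=> [/eqP|E]; last by rewrite E mulr0.
  by rewrite mulf_eq0 (negPf s0) => /eqP.
have HrE (oI : open I) (I0 : I `<=` [set y | 0 < y]) (C2 : C2_real I lam) :
    minimal_graph (it n) s.+1 (strip I) (lam \o @hyp_y R n) <->
    forall y, I y -> radial_eq alpha s y (derive1 lam y) (derive1n 2 lam y).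
  rewrite /minimal_graph graph_map_t.
  have reg (y : R) : I y ->
      0 < derive1 id y ^+ 2 + id y ^+ 2 * derive1 lam y ^+ 2.
    by rewrite derive1_id expr1n ltr_pwDl// mulr_ge0// sqr_ge0.
  have [H1 H2] := Hr_zero_profile oI (@C2_real_id _ I) C2 I0 reg sn1.
  split=> [/H1|] E; last apply: H2; move=> y Iy; have := E _ Iy.
    by rewrite derive1_id derive2_id; apply: (eqE _ _ _ (I0 _ Iy)).1.
  by rewrite derive1_id derive2_id; apply: (eqE _ _ _ (I0 _ Iy)).2.
split=> [[oI itvI In0 I0 [C2 H]]|[oI itvI In0 I0 [C2 H]]]; split=> //; split=> //.
  exact/HrE.
exact/HrE.
Qed.

Lemma solution_parabolic (I : set R) v lam :
  open I -> is_interval I -> I !=set0 -> I `<=` [set y | 0 < y] ->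
  solution alpha I v lam -> parabolic_solution n s.+1 I lam.
Proof.
move=> oI itvI In0 I0 sol; apply/parabolic_solutionP; split=> //; split.
  by have [] := solution_derive2 oI I0 sol.
exact: solution_radial_eq sol.
Qed.

Lemma parabolic_first_integral (I : set R) lam :
  parabolic_solution n s.+1 I lam ->
  exists k, forall y, I y -> sine (y * derive1 lam y) = k * y `^ alpha.
Proof.
move=> /parabolic_solutionP[oI itvI In0 I0 [C2 E]].
exact: radial_first_integral E.
Qed.

End ParabolicSolutions.

(** * Maximality and classification *)

Section MaximalSolutions.
Variables (R : realType) (n s : nat).
Hypothesis (n_gt0 : (0 < n)%N) (sn : (s < n)%N).
Let alpha := arcsin_exponent R n s.+1.
Local Notation half_line := [set y : R | 0 < y].

Lemma half_line_open : open half_line.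
Proof. exact: open_gt. Qed.

Lemma half_line_interval : is_interval half_line.
Proof. by move=> x y x0 y0 z /andP[xz _]; exact: lt_le_trans xz. Qed.

Lemma half_line_neq0 : half_line !=set0.
Proof. by exists 1; exact: ltr01. Qed.

Lemma solution_half_line v lam :
  solution alpha half_line v lam -> parabolic_solution n s.+1 half_line lam.
Proof.
exact: (solution_parabolic n_gt0 sn half_line_open half_line_interval
  half_line_neq0).
Qed.

Lemma solution_itv v lam (e : R) : 0 < e ->
  solution alpha `]0, e[ v lam -> parabolic_solution n s.+1 `]0, e[ lam.
Proof.
move=> e0; apply: (solution_parabolic n_gt0 sn).
- exact: interval_open.
- exact: interval_is_interval.
- by exists (e / 2); rewrite /= in_itv/= divr_gt0// ltr_pdivrMr// ltr_pMr// ltr1n.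
- by move=> y /=; rewrite in_itv/= => /andP[].
Qed.

(** A reflection changes the sign of y lam'. Its square is unaffected, and this is all that the
    maximality argument reads from it. *)
Lemma congruent_solution (J I : set R) v mu lam : open J ->
  solution alpha J v mu -> vertically_congruent I lam J mu ->
  exists2 w, solution alpha I w lam & forall y, w y ^+ 2 = v y ^+ 2.
Proof.
move=> oJ sol [-> [b [lb|lb]]].
  exists v => //; apply: (solution_eq oJ _ (solution_shift b sol)) => y Jy.
  by rewrite lb.
exists (fun y => - v y); last by move=> y; rewrite sqrrN.
by apply: (solution_eq oJ _ (solution_reflect b sol)) => y Jy; rewrite lb.
Qed.

Lemma half_line_maximal lam : parabolic_solution n s.+1 half_line lam ->
  maximal_parabolic_solution n s.+1 half_line lam.
Proof.
move=> par; split=> // J mu [_ _ _ J0 _] IJ _.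
by apply/seteqP; split.
Qed.

Lemma arcsin_exponent_eq0 : n = s.+1 -> alpha = 0.
Proof. by move=> ns; rewrite /alpha /arcsin_exponent ns subrr mul0r. Qed.

Lemma arcsin_exponent_gt0 : (s.+1 < n)%N -> 0 < alpha.
Proof. by move=> sn'; rewrite divr_gt0 ?ltr0n// subr_gt0 ltr_nat. Qed.

Lemma arcsin_profileE c : arcsin_profile n s.+1 c = asin_profile alpha c.
Proof. by apply/funext => y; rewrite /asin_profile invf_div. Qed.

Lemma arcsin_endE (c : R) : arcsin_end n s.+1 c = c `^ alpha^-1.
Proof. by rewrite /arcsin_end invf_div. Qed.

(** An extension [mu] has a first integral with some constant k. Agreement with [lam] at a single
    point gives k^2 = 1/c^2, and |k y^alpha| < 1 on all of [J] then confines [J] to the original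
    interval. *)
Lemma asin_maximal (c : R) I lam : (s.+1 < n)%N -> 0 < c ->
  vertically_congruent I lam `]0, c `^ alpha^-1[ (asin_profile alpha c) ->
  maximal_parabolic_solution n s.+1 I lam.
Proof.
move=> sn' c0 lamP; have a0 := arcsin_exponent_gt0 sn'.
have e0 : 0 < c `^ alpha^-1 by exact: powR_gt0.
have sol := solution_asin a0 c0.
have oE : open `]0, c `^ alpha^-1[%classic by exact: interval_open.
have [w solI w2] := congruent_solution oE sol lamP.
have IE := lamP.1; rewrite IE in solI; rewrite IE; split.
  exact: solution_itv solI.
move=> J mu parJ IJ mulam; apply/seteqP; split=> // y Jy.
have [oJ itvJ _ J0 _] := parJ.
have [k kP] := parabolic_first_integral n_gt0 sn parJ.
have [x Ix] : `]0, c `^ alpha^-1[ !=set0.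
  exists (c `^ alpha^-1 / 2).
  by rewrite /= in_itv/= divr_gt0//= ltr_pdivrMr// ltr_pMr// ltr1n.
have x0 : 0 < x by move: Ix; rewrite /= in_itv/= => /andP[].
have xc : x < c `^ alpha^-1 by move: Ix; rewrite /= in_itv/= => /andP[].
pose z := x `^ alpha / c.
have z0 : 0 < z by rewrite divr_gt0// powR_gt0.
have z1 : z ^+ 2 < 1 by rewrite expr_lt1// ?powR_lt_endE// ltW.
have dmu : derive1 mu x = w x / x.
  have [dlam _] := solI _ Ix; apply: is_derive_derive1.
  apply: is_derive_near dlam; near=> t; rewrite mulam//; near: t.
  by apply: open_nbhs_nbhs; split.
(* Squares are compared because [lam] may be a reflected profile, which leaves the sign of k
   undetermined. *)
have kz : (k * x `^ alpha) ^+ 2 = z ^+ 2.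
  rewrite -kP; last exact: IJ.
  rewrite dmu [x * _]mulrC divfK ?gt_eqF//.
  have -> : sine (w x) ^+ 2 = 1 - (1 + w x ^+ 2)^-1 by rewrite -sine_sqr subKr.
  have d0 : 1 - z ^+ 2 != 0 by rewrite subr_eq0 gt_eqF.
  rewrite w2 -/z expr_div_n sqr_sqrtr ?subr_ge0 ?ltW//.
  by field; rewrite d0 subrK oner_neq0.
have k2 : k ^+ 2 = c^-1 ^+ 2.
  move: kz; rewrite /z [x `^ _ / c]mulrC !exprMn; apply: mulIf.
  by rewrite expf_neq0// gt_eqF// powR_gt0.
have y0 := J0 _ Jy; rewrite /= in_itv/= y0/= -powR_lt_endE//.
rewrite -(@ltr_pXn2r _ 2)// ?nnegrE ?divr_ge0 ?powR_ge0 ?(ltW c0)// expr1n.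
rewrite mulrC exprMn -k2 -exprMn -real_normK ?num_real// expr_lt1//.
by have [] := sine_inv (kP _ Jy).
Unshelve. all: by end_near. Qed.

(** In each case the first integral gives a formula for [lam] on [I] that still defines a solution
    on the full stated domain; maximality then forces [I] to be that domain. The case k = 0 is the
    slice, and otherwise the sign of n - r selects the profile. *)
Theorem maximal_parabolic_classification (I : set R) lam :
  maximal_parabolic_solution n s.+1 I lam <->
  [\/ I = half_line /\ exists b : R, forall y, I y -> lam y = b,
      n = s.+1 /\ exists2 c : R, 0 < c &
        vertically_congruent I lam half_line (log_profile c)
    | (s.+1 < n)%N /\ exists2 c : R, 0 < c &
        vertically_congruent I lam
          `]0, arcsin_end n s.+1 c[ (arcsin_profile n s.+1 c)].
Proof.
split=> [[par maxi]|]; last first.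
- case=> [[IE [b lb]]|[ns [c c0 lamP]]|[sn' [c c0]]].
  + rewrite IE in lb; rewrite IE; apply: half_line_maximal.
    apply: (@solution_half_line (fun=> 0)).
    apply: (solution_eq half_line_open _ (@solution_cst R alpha half_line b)).
    by move=> y y0; rewrite lb.
  + have [w sol _] := congruent_solution half_line_open
      (solution_ln c (arcsin_exponent_eq0 ns)) lamP.
    have IE := lamP.1; rewrite IE in sol; rewrite IE.
    exact/half_line_maximal/(solution_half_line sol).
  + by rewrite arcsin_profileE arcsin_endE; exact: asin_maximal.
have [oI itvI In0 I0 [C2 _]] := par.
have dlam y : I y -> derivable lam y 1 by move=> /C2[].
have [k kP] := parabolic_first_integral n_gt0 sn par.
have [k0|k0] := eqVneq k 0.
  have [b lb] := first_integral0 itvI In0 I0 dlam kP k0.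
  apply: Or31; split; last by exists b.
  apply/esym/(maxi _ (fun=> b)) => // [|y Iy]; last by rewrite lb.
  exact: solution_half_line (@solution_cst R alpha half_line b).
have := sn; rewrite leq_eqVlt => /orP[/eqP ns|sn'].
  have [c c0 [b lb]] :=
    first_integral_ln itvI In0 I0 dlam kP (arcsin_exponent_eq0 (esym ns)) k0.
  apply: Or32; split=> //; exists c => //; split; last by exists b.
  have sol := solution_ln c (arcsin_exponent_eq0 (esym ns)).
  case: lb => lb; apply/esym.
    apply: (maxi _ (fun y => log_profile c y + b)) => // [|y Iy].
      exact: solution_half_line (solution_shift b sol).
    by rewrite lb.
  apply: (maxi _ (fun y => b - log_profile c y)) => // [|y Iy].
    exact: solution_half_line (solution_reflect b sol).
  by rewrite lb.
have [c c0 [Ic [b lb]]] :=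
  first_integral_asin itvI In0 I0 dlam kP (arcsin_exponent_gt0 sn') k0.
apply: Or33; split=> //; exists c => //; rewrite arcsin_profileE arcsin_endE.
split; last by exists b.
have e0 : 0 < c `^ alpha^-1 by exact: powR_gt0.
have sol := solution_asin (arcsin_exponent_gt0 sn') c0.
case: lb => lb; apply/esym.
  apply: (maxi _ (fun y => asin_profile alpha c y + b)) => // [|y Iy].
    exact: solution_itv (solution_shift b sol).
  by rewrite lb.
apply: (maxi _ (fun y => b - asin_profile alpha c y)) => // [|y Iy].
  exact: solution_itv (solution_reflect b sol).
by rewrite lb.
Qed.

End MaximalSolutions.

(** * The horizontal graph *)

Section HorizontalProfile.
Variables (R : realType) (alpha c : R).
Hypotheses (a0 : 0 < alpha) (c0 : 0 < c).

Definition t_itv : set R := `]0, pi / alpha[.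

(* The inverse of the arcsine profile, continued past its maximum: the glued
   hypersurface is y = sine_profile t. *)
Definition sine_profile (t : R) : R := (c * sin (alpha * t)) `^ alpha^-1.

Lemma t_itvE t : t_itv t <-> 0 < t /\ t < pi / alpha.
Proof. by rewrite /t_itv /= in_itv/=; split=> [/andP[]|[-> ->]]. Qed.

Lemma t_itv_open : open t_itv.
Proof. exact: interval_open. Qed.

Lemma sin_gt0_t_itv t : t_itv t -> 0 < sin (alpha * t).
Proof.
move=> /t_itvE[t0 tp]; apply: sin_gt0_pi; rewrite mulr_gt0//=.
by rewrite mulrC -ltr_pdivlMr.
Qed.

Lemma sine_profile_gt0 t : t_itv t -> 0 < sine_profile t.
Proof. by move=> /sin_gt0_t_itv st; rewrite powR_gt0// mulr_gt0. Qed.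

Lemma is_derive_alpha_mul (t : R) : is_derive t 1 (fun t => alpha * t) alpha.
Proof.
apply: (is_derive_eq
  (is_derive_mul (is_derive_cst alpha t 1) (is_derive_id t 1))).
by rewrite mul0r add0r mulr1.
Qed.

Lemma is_derive_sin_alpha (t : R) :
  is_derive t 1 (fun t => sin (alpha * t)) (alpha * cos (alpha * t)).
Proof.
have d := is_derive_alpha_mul t.
apply: (is_derive_eq (is_derive_comp (f := sin) (is_derive_sin (alpha * t)) d)).
by rewrite mulrC.
Qed.

Lemma is_derive_cos_alpha (t : R) :
  is_derive t 1 (fun t => cos (alpha * t)) (- alpha * sin (alpha * t)).
Proof.
have d := is_derive_alpha_mul t.
apply: (is_derive_eq (is_derive_comp (f := cos) (is_derive_cos (alpha * t)) d)).
by rewrite mulrC mulrN mulNr.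
Qed.

(** The cotangent of alpha t, which is the logarithmic derivative of [sine_profile]. *)
Definition cot (t : R) : R := cos (alpha * t) / sin (alpha * t).

Lemma is_derive_sine_profile t : t_itv t ->
  is_derive t 1 sine_profile (sine_profile t * cot t).
Proof.
move=> /sin_gt0_t_itv st.
have s0 : 0 < c * sin (alpha * t) by rewrite mulr_gt0.
have d := is_derive_mul (is_derive_cst c t 1) (is_derive_sin_alpha t).
apply: (is_derive_eq (is_derive_comp (f := (@powR R)^~ alpha^-1)
  (g := fun t => c * sin (alpha * t))
  (is_derive1_powR alpha^-1 s0) d)).
rewrite powRB; last by rewrite (gt_eqF s0) implybT.
rewrite powRr1 ?ltW// /= mul0r add0r /cot -/(sine_profile t).
by field; rewrite !gt_eqF.
Qed.

Lemma is_derive_cot t : t_itv t ->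
  is_derive t 1 cot (- alpha / sin (alpha * t) ^+ 2).
Proof.
move=> /sin_gt0_t_itv st.
apply: (is_derive_eq (is_derive_mul (is_derive_cos_alpha t)
  (is_derive_inv (lt0r_neq0 st) (is_derive_sin_alpha t)))).
transitivity (- alpha * (cos (alpha * t) ^+ 2 + sin (alpha * t) ^+ 2) /
    sin (alpha * t) ^+ 2); first by field; rewrite gt_eqF.
by rewrite cos2Dsin2 mulr1.
Qed.

Lemma sine_profile_C2 : [/\ C2_real t_itv sine_profile,
  forall t, t_itv t -> derive1 sine_profile t = sine_profile t * cot t
  & forall t, t_itv t -> derive1n 2 sine_profile t =
      sine_profile t * (cot t ^+ 2 - alpha / sin (alpha * t) ^+ 2)].
Proof.
apply: (C2_real_of t_itv_open is_derive_sine_profile) => t It.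
  apply: (is_derive_eq
    (is_derive_mul (is_derive_sine_profile It) (is_derive_cot It))).
  by ring.
have cg := is_derive_continuous (is_derive_sine_profile It).
have cc := is_derive_continuous (is_derive_cot It).
have cs := is_derive_continuous (is_derive_sin_alpha t).
have s0 : sin (alpha * t) ^+ 2 != 0 by rewrite expf_neq0// gt_eqF// sin_gt0_t_itv.
apply: (continuousM cg); apply: continuousB; first exact: (continuousM cc cc).
apply: continuousM; first exact: cst_continuous.
by apply: continuousV => //; exact: (continuousM cs cs).
Qed.

End HorizontalProfile.

(** * H_r = 0 on the horizontal graph *)

Section HorizontalMinimal.
Variables (R : realType) (n s : nat).
Hypothesis (n_gt0 : (0 < n)%N) (sn : (s.+1 < n)%N).
Let alpha := arcsin_exponent R n s.+1.

(** This chart covers the gluing locus too, where the vertical description breaks down. With T = id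
    the equation reduces to 1 + cot^2 = 1 / sin^2. *)
Lemma sine_profile_minimal (c : R) : 0 < c ->
  minimal_graph (iy n) s.+1 (strip (t_itv alpha))
    (sine_profile alpha c \o @hyp_y R n).
Proof.
move=> c0; have a0 : 0 < alpha by exact: arcsin_exponent_gt0.
have [C2 g1 g2] := sine_profile_C2 a0 c0.
rewrite /minimal_graph graph_map_y.
have reg t : t_itv alpha t -> 0 < derive1 (sine_profile alpha c) t ^+ 2 +
    sine_profile alpha c t ^+ 2 * derive1 id t ^+ 2.
  move=> It; rewrite derive1_id expr1n mulr1 ltr_wpDl ?sqr_ge0//.
  by rewrite exprn_gt0// sine_profile_gt0.
have sn1 : (s <= n.-1)%N by rewrite -ltnS prednK// ltnW.
have [_ H] := Hr_zero_profile (@t_itv_open R alpha) C2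
  (@C2_real_id R (t_itv alpha)) (sine_profile_gt0 a0 c0) reg sn1.
apply: H => t It.
have st := sin_gt0_t_itv a0 It; have gt := sine_profile_gt0 a0 c0 It.
rewrite derive1_id derive2_id g1// g2// /profile_eq.
rewrite (arcsin_exponentE R n_gt0 (ltnW sn)) -/alpha.
set g := sine_profile alpha c t in gt *.
have ct : cot alpha t ^+ 2 = (sin (alpha * t) ^+ 2)^-1 - 1.
  rewrite /cot expr_div_n -[in RHS](@divff _ (sin (alpha * t) ^+ 2)); last first.
    by rewrite expf_neq0// gt_eqF.
  by rewrite -[X in X - _]mul1r -mulrBl -(cos2Dsin2 (alpha * t)) addrK.
have -> : s.+1%:R * (g * cot alpha t * 0 - 1 *
    (g * (cot alpha t ^+ 2 - alpha / sin (alpha * t) ^+ 2)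
     - (g * cot alpha t) ^+ 2 / g)) -
    s.+1%:R * alpha * (g * 1) *
    ((g * cot alpha t) ^+ 2 / g ^+ 2 + 1 ^+ 2) =
  s.+1%:R * alpha * g * ((sin (alpha * t) ^+ 2)^-1 - 1 - cot alpha t ^+ 2).
  by field; rewrite !gt_eqF.
by rewrite ct subrr !mulr0.
Qed.

End HorizontalMinimal.

(** * The glued vertical graphs form one horizontal graph *)

Section ProfileImage.
Variables (R : realType) (n : nat).
Local Notation it := (it n).
Local Notation iy := (iy n).
Local Notation last := (@ord_max n.-1).
Implicit Types (p : hpoint R n) (I : set R).

Lemma profile_imageP I (Y T : R -> R) p :
  (profile_map Y T @` strip I) p <->
  exists2 s, I s & ycoord p = Y s /\ tcoord p = T s.
Proof.
split=> [[q Iq <-]|[s Is [py pt]]].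
  by exists (hyp_y q) => //; rewrite hrow_y eqxx /tcoord hrow_it.
exists (\row_i (if i == last then s else p 0 (lift it i))).
  by rewrite /strip/= /hyp_y mxE eqxx.
apply/esym/hrowP => [|i]; rewrite !mxE eqxx//.
by have [->|_] := eqVneq i last.
Qed.

Lemma vgraphE I lam :
  vgraph n I lam = [set p | I (ycoord p) /\ tcoord p = lam (ycoord p)].
Proof.
apply/seteqP; split=> p; rewrite /vgraph graph_map_t.
  by move=> /profile_imageP[s Is [/= -> ->]].
by move=> [Iy pt]; apply/profile_imageP; exists (ycoord p).
Qed.

Lemma hgraphE I g : graph_map iy (g \o @hyp_y R n) @` strip I =
  [set p | I (tcoord p) /\ ycoord p = g (tcoord p)].
Proof.
apply/seteqP; split=> p; rewrite graph_map_y.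
  by move=> /profile_imageP[s Is [/= -> ->]].
by move=> [Iy pt]; apply/profile_imageP; exists (tcoord p).
Qed.

End ProfileImage.

Section ArcsineProfile.
Variables (R : realType) (alpha c : R).
Hypotheses (a0 : 0 < alpha) (c0 : 0 < c).
Let e := c `^ alpha^-1.
Let t0 := pi / 2 / alpha.
Let lam := asin_profile alpha c.
Let g := sine_profile alpha c.

Let at0 : alpha * t0 = pi / 2.
Proof. by rewrite /t0; field; rewrite gt_eqF. Qed.

Let e_gt0 : 0 < e.
Proof. exact: powR_gt0. Qed.

Let t0_gt0 : 0 < t0.
Proof. by rewrite !divr_gt0// pi_gt0. Qed.

Let t02 : pi / alpha = 2 * t0.
Proof. by rewrite /t0; field; rewrite gt_eqF. Qed.

Let pihalf_ge0 : 0 <= pi / 2 :> R.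
Proof. by rewrite divr_ge0// pi_ge0. Qed.

Let in_pihalf (x : R) : 0 <= x <= pi / 2 -> x \in `[- (pi / 2), pi / 2].
Proof.
by move=> /andP[x0 x1]; rewrite in_itv/= x1 (le_trans _ x0)// oppr_le0.
Qed.

Lemma asin_gt0 (z : R) : 0 < z <= 1 -> 0 < asin z.
Proof.
move=> /andP[z0 z1]; have zi : -1 <= z <= 1.
  by rewrite z1 (le_trans _ (ltW z0))// lerN10.
have i0 : 0 \in `[- (pi / 2), pi / 2 : R] by rewrite in_pihalf ?lexx.
have iz : asin z \in `[- (pi / 2), pi / 2 : R].
  by rewrite in_itv/= asin_geNpi2// asin_lepi2.
by rewrite -(ltr_sin i0 iz) sin0 asinK// in_itv.
Qed.

Lemma sin_lt1_pihalf (x : R) : 0 < x < pi / 2 -> sin x < 1.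
Proof.
move=> /andP[x0 x1].
by rewrite -sin_pihalf ltr_sin// in_pihalf// ?lexx ?andbT// !ltW.
Qed.

Lemma sine_profile_powR t : 0 <= sin (alpha * t) ->
  g t `^ alpha = c * sin (alpha * t).
Proof.
move=> st; rewrite /g /sine_profile -powRrM mulVf ?gt_eqF//.
by rewrite powRr1// mulr_ge0// ltW.
Qed.

(** Here alpha [lam y] is an arcsine in (0, pi/2), where sine and arcsine are inverse to each other;
    the powers alpha and 1/alpha cancel likewise. *)
Lemma asin_profileK y : 0 < y < e ->
  [/\ 0 < lam y, lam y < t0 & g (lam y) = y].
Proof.
move=> /andP[y0 ye]; pose z := y `^ alpha / c.
have z0 : 0 < z by rewrite divr_gt0// powR_gt0.
have z1 : z < 1 by rewrite powR_lt_endE.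
have zN : -1 <= z by rewrite (le_trans _ (ltW z0))// lerN10.
have al : alpha * lam y = asin z.
  by rewrite /lam /asin_profile mulrA divff ?gt_eqF// mul1r.
split.
- by rewrite mulr_gt0 ?invr_gt0// asin_gt0// z0 ltW.
- by rewrite -(ltr_pM2l a0) al at0 asin_ltpi2// zN.
- rewrite /g /sine_profile al asinK ?in_itv/= ?zN ?ltW//.
  rewrite /z mulrC divfK ?gt_eqF// -powRrM divff ?gt_eqF// powRr1//.
  exact: ltW.
Qed.

Lemma sine_profileK t : 0 < t < t0 -> 0 < g t < e /\ lam (g t) = t.
Proof.
move=> /andP[t_gt0 tt0].
have xi : 0 < alpha * t < pi / 2 by rewrite mulr_gt0//= -at0 ltr_pM2l.
have s0 := sin_gt0_pihalf xi; have s1 := sin_lt1_pihalf xi.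
have gt0 : 0 < g t by rewrite powR_gt0// mulr_gt0.
have gE : g t `^ alpha / c = sin (alpha * t).
  by rewrite sine_profile_powR ?ltW// mulrC mulKf// gt_eqF.
split; first by rewrite gt0 -powR_lt_endE// gE.
rewrite /lam /asin_profile gE sinK ?mulKf ?gt_eqF// in_itv/=.
by have := in_pihalf (x := alpha * t); rewrite in_itv/=; apply; case/andP: xi;
  move=> x0 x1; rewrite !ltW.
Qed.

Lemma sine_profile_mid : g t0 = e.
Proof. by rewrite /g /sine_profile at0 sin_pihalf mulr1. Qed.

Lemma sine_profile_sym t : g (2 * t0 - t) = g t.
Proof.
rewrite /g /sine_profile mulrBr mulrCA at0 [2 * _]mulrC divfK//.
by rewrite sinB sinpi cospi mul0r sub0r mulN1r opprK.
Qed.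

(** The three pieces are the parts t < t0, t = t0 and t > t0 of the horizontal graph. The last is
    reduced to the first by the symmetry t -> 2 t0 - t, that is, sin(pi - x) = sin(x). *)
Lemma gluedE n : glued n lam e t0 =
  [set p | t_itv alpha (tcoord p) /\ ycoord p = g (tcoord p)].
Proof.
apply/seteqP; split=> p.
  move=> [[|[py pt]]|].
  - rewrite vgraphE => -[/=]; rewrite in_itv/= => yi ->.
    have [l0 l1 ->] := asin_profileK yi; split=> //; apply/t_itvE.
    by rewrite t02 l0; split=> //; rewrite (lt_trans l1)// ltr_pMl// ltr1n.
  - rewrite /= py pt sine_profile_mid; split=> //; apply/t_itvE.
    by rewrite t02 t0_gt0; split=> //; rewrite ltr_pMl// ltr1n.
  - rewrite vgraphE => -[/=]; rewrite in_itv/= => yi ->.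
    have [l0 l1] := asin_profileK yi; rewrite sine_profile_sym => ->.
    split=> //; apply/t_itvE; rewrite t02 subr_gt0 ltrBlDr ltrDl l0; split=> //.
    by rewrite (lt_trans l1)// ltr_pMl// ltr1n.
move=> [/t_itvE[]]; rewrite t02 => t_gt0 tt0 py.
have [tlt|tgt|tE] := ltgtP (tcoord p) t0.
- have ti : 0 < tcoord p < t0 by rewrite t_gt0.
  have [gi lg] := sine_profileK ti.
  by left; left; rewrite vgraphE /= py lg in_itv.
- have ti : 0 < 2 * t0 - tcoord p < t0.
    by rewrite subr_gt0 tt0/= ltrBlDr mulr_natl mulr2n ltrD2l.
  have [gi lg] := sine_profileK ti; rewrite sine_profile_sym in gi lg.
  by right; rewrite vgraphE /= py lg in_itv/=; split=> //; rewrite subKr.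
- by left; right; rewrite /= py tE sine_profile_mid.
Qed.

(** The argument is monotonicity of the inverse: if y lies between [g t] and [e], then [lam y] lies
    between t and [t0], and t may be taken arbitrarily close to [t0]. *)
Lemma asin_profile_cvg : lam y @[y --> e^'-] --> t0.
Proof.
apply/cvgrPdist_lt => eps eps0.
(* Half of the minimum keeps t within [eps] of [t0] and strictly between 0 and [t0]. *)
pose t := t0 - Num.min eps t0 / 2.
have m0 : 0 < Num.min eps t0 by rewrite lt_min eps0 t0_gt0.
have ti : 0 < t < t0.
  rewrite subr_gt0 gtrBl divr_gt0// andbT ltr_pdivrMr//.
  by rewrite (le_lt_trans (_ : _ <= t0)) ?ge_min ?lexx ?orbT// ltr_pMr// ltr1n.
have [/andP[gt0 gte] lg] := sine_profileK ti.
near=> y.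
have gy : g t < y by near: y; exact: nbhs_left_gt.
have ye : y < e by near: y; exact: nbhs_left_lt.
have yi : 0 < y < e by rewrite ye (lt_trans gt0).
have [l0 l1 gl] := asin_profileK yi.
rewrite ger0_norm ?subr_ge0 ?ltW//.
have tl : t < lam y.
  case/andP: ti => t_gt0 tt0.
  have xi x : 0 < x -> x < t0 -> 0 < alpha * x < pi / 2.
    by move=> x0 xt; rewrite mulr_gt0//= -at0 ltr_pM2l.
  have xc x : 0 < alpha * x < pi / 2 -> alpha * x \in `[- (pi / 2), pi / 2].
    by case/andP => x0 x1; rewrite in_pihalf// !ltW.
  have ti := xi _ t_gt0 tt0; have li := xi _ l0 l1.
  rewrite -(ltr_pM2l a0) -(ltr_sin (xc _ ti) (xc _ li)) -(ltr_pM2l c0).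
  rewrite -!sine_profile_powR ?gl ?ltW// ?sin_gt0_pihalf//.
  by rewrite gt0_ltr_powR// nnegrE ltW.
rewrite ltrBlDr -ltrBlDl (le_lt_trans _ tl)// /t lerD2l lerN2.
rewrite ler_pdivrMr// (le_trans (_ : _ <= eps)) ?ge_min ?lexx//.
by rewrite ler_peMr ?ler1n// ltW.
Unshelve. all: by end_near. Qed.

End ArcsineProfile.

(** * Invariance and asymptotic boundary of the horizontal graph *)

Section SineGraph.
Variables (R : realType) (n : nat) (alpha c : R).
Hypotheses (a0 : 0 < alpha) (c0 : 0 < c).
Local Notation it := (it n).
Local Notation iy := (iy n).
Local Notation last := (@ord_max n.-1).
Local Notation hpoint := (hpoint R n).
Let g := sine_profile alpha c.

Definition sine_graph : set hpoint :=
  [set p | t_itv alpha (tcoord p) /\ ycoord p = g (tcoord p)].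

Lemma sine_graph_horizontal :
  horizontal_graph sine_graph (strip (t_itv alpha)) (g \o @hyp_y R n).
Proof.
split; first exact/strip_open/t_itv_open.
  by move=> q Iq; exact: sine_profile_gt0.
by rewrite hgraphE.
Qed.

Lemma t_strip_neqT : strip (n := n) (t_itv alpha) <> [set: chart R n].
Proof.
move=> E; have : strip (n := n) (t_itv alpha) 0 by rewrite E.
by rewrite /strip/= /hyp_y mxE => /t_itvE[]; rewrite ltxx.
Qed.

Lemma sine_profile_le t : t_itv alpha t -> g t <= c `^ alpha^-1.
Proof.
move=> /(sin_gt0_t_itv a0) st; rewrite ge0_ler_powR ?invr_ge0 ?nnegrE ?(ltW a0)//.
- by rewrite ltW// mulr_gt0.
- exact: ltW.
- by rewrite ler_piMr ?sin_le1// ltW.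
Qed.

(** An entire vertical graph has points at every y > 0, whereas y is at most c^(1/alpha) here; the
    point tested has y = c^(1/alpha) + 1. *)
Lemma sine_graph_not_entire : ~ entire_vertical_graph sine_graph.
Proof.
move=> [u E]; pose q : chart R n := \row__ (c `^ alpha^-1 + 1).
have : sine_graph (graph_map it u q).
  by rewrite E; exists q => //; rewrite /hyp/= /hyp_y mxE ltr_wpDl// powR_ge0.
move=> [/sine_profile_le + yE]; rewrite -yE /ycoord mxE liftK mxE.
by rewrite gerDl ler10.
Qed.

Lemma sine_graph_parabolic : parabolic_invariant sine_graph.
Proof.
move=> p v v0 t0 [It yt]; rewrite /sine_graph/= /tcoord /ycoord !mxE.
by rewrite -/(tcoord v) -/(ycoord v) v0 t0 !addr0.
Qed.

(** The rows are the coordinate vectors of the x-variables: [lift last] skips y and [lift it] skips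
    t. *)
Definition horizontal_rows : 'M[R]_(n.-1, n.-1.+2) :=
  \matrix_(i, l) (l == lift it (lift last i))%:R.

Lemma mul_horizontal_rows (w : 'rV[R]_n.-1) :
  w *m horizontal_rows =
  hrow 0 (fun j => if unlift last j is Some k then w 0 k else 0).
Proof.
apply: hrowP => [|j].
  by rewrite mxE big1// => i _; rewrite mxE (negPf (neq_lift _ _)) mulr0.
rewrite mxE; case: unliftP => [k ->|->].
  under eq_bigr do rewrite mxE !(inj_eq (@lift_inj _ _)) eq_sym mulrC.
  by rewrite sum_delta.
rewrite big1// => i _; rewrite mxE (inj_eq (@lift_inj _ _)).
by rewrite (negPf (neq_lift _ _)) mulr0.
Qed.

Lemma row_free_horizontal_rows : row_free horizontal_rows.
Proof.
apply/row_freeP; exists horizontal_rows^T; apply/matrixP => i j.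
rewrite !mxE; under eq_bigr do rewrite !mxE.
rewrite sum_delta (inj_eq (@lift_inj _ _)) (inj_eq (@lift_inj _ _)).
by rewrite eq_sym.
Qed.

Definition boundary_plane (t : R) : set hpoint :=
  [set p | ycoord p = 0 /\ tcoord p = t].

Lemma boundary_planeE t : boundary_plane t =
  [set hrow t (fun=> 0) + w *m horizontal_rows | w in [set: 'rV[R]_n.-1]].
Proof.
apply/seteqP; split=> [p [py pt]|p [w _ <-]].
  exists (\row_k p 0 (lift it (lift last k))) => //.
  rewrite mul_horizontal_rows; apply/rowP => l; rewrite mxE.
  have [j ->|->] := unliftP it l; last by rewrite !hrow_it addr0.
  rewrite !hrow_lift add0r; case: unliftP => [k ->|->]; first by rewrite mxE.
  by rewrite -[RHS]/(ycoord p) py.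
rewrite /boundary_plane/= /ycoord /tcoord mul_horizontal_rows.
rewrite !mxE unlift_none addr0; split=> //.
by rewrite liftK unlift_none addr0.
Qed.

Lemma boundary_planes_parallel (t t' : R) : t <> t' ->
  parallel_planes n.-1 (boundary_plane t) (boundary_plane t').
Proof.
move=> tt'; exists horizontal_rows, (hrow t (fun=> 0)), (hrow t' (fun=> 0)).
split; [exact: row_free_horizontal_rows|exact: boundary_planeE|
  exact: boundary_planeE|move=> E].
have : boundary_plane t (hrow t (fun=> 0)).
  by split; rewrite ?hrow_y// /tcoord hrow_it.
by rewrite E => -[_]; rewrite /tcoord hrow_it.
Qed.

Lemma tcoord_continuous : continuous (@tcoord R n).
Proof. exact: coord_continuous. Qed.

Lemma ycoord_continuous : continuous (@ycoord R n).
Proof. exact: coord_continuous. Qed.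

(** The base of the power tends to 0, so the bound c sin(alpha t) < e^alpha is established and then
    raised to the power 1/alpha. *)
Lemma sine_profile_cvg0 : g t @[t --> 0^'+] --> 0.
Proof.
apply/cvgrPdist_lt => e e0.
have cs : c * sin (alpha * t) @[t --> (0 : R)] --> 0.
  have d := is_derive_mul (is_derive_cst c (0 : R) 1)
    (is_derive_sin_alpha alpha 0).
  have cd : c * sin (alpha * t) @[t --> (0 : R)] --> c * sin (alpha * 0).
    exact: (is_derive_continuous d).
  by rewrite mulr0 sin0 mulr0 in cd.
have ea0 : 0 < e `^ alpha by exact: powR_gt0.
near=> t.
have It : t_itv alpha t.
  apply/t_itvE; split; first by near: t; exact: nbhs_right_gt.
  by near: t; apply: nbhs_right_lt; rewrite divr_gt0// pi_gt0.
have st := sin_gt0_t_itv a0 It.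
rewrite sub0r normrN ger0_norm ?powR_ge0//.
have -> : e = (e `^ alpha) `^ alpha^-1.
  by rewrite -powRrM divff ?gt_eqF// powRr1// ltW.
rewrite gt0_ltr_powR ?invr_gt0 ?nnegrE ?(ltW ea0)//.
  by rewrite ltW// mulr_gt0.
rewrite (le_lt_trans (ler_norm _))// -normrN -sub0r; near: t.
have /cvgrPdist_lt := cvg_at_right_filter cs.
by apply.
Unshelve. all: by end_near. Qed.

(** Points with fixed x, height [T t] and y = [g t] approach [p]. The function [T] allows both ends
    of the interval to be treated at once: the identity for t = 0, and t -> pi/alpha - t for the
    other end. *)
Lemma sine_graph_closure (p : hpoint) (T : R -> R) : ycoord p = 0 ->
  (T t @[t --> 0^'+] --> tcoord p) ->
  (forall t, t_itv alpha t -> t_itv alpha (T t) /\ g (T t) = g t) ->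
  closure sine_graph p.
Proof.
move=> py Tt gT B pB.
pose x (j : 'I_n.-1.+1) t := if j == last then g t else p 0 (lift it j).
have cq : hrow (T t) (x^~ t) @[t --> 0^'+] --> p.
  apply: cvg_row => l; have [j ->|->] := unliftP it l.
    rewrite (_ : (fun t => _) = x j); last first.
      by apply/funext => t; rewrite hrow_lift.
    rewrite /x; have [->|_] := eqVneq j last; last exact: cvg_cst.
    by rewrite -[p 0 _]/(ycoord p) py; exact: sine_profile_cvg0.
  rewrite (_ : (fun t => _) = T)//; apply/funext => t; exact: hrow_it.
have It : \forall t \near 0^'+, t_itv alpha t.
  near=> t; apply/t_itvE; split; first by near: t; exact: nbhs_right_gt.
  by near: t; apply: nbhs_right_lt; rewrite divr_gt0// pi_gt0.
have Bt : \forall t \near 0^'+, B (hrow (T t) (x^~ t)) by exact: cq.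
have [t [{}Bt Itt]] : exists t, B (hrow (T t) (x^~ t)) /\ t_itv alpha t.
  by near ((0 : R)^'+) => t; exists t; split; near: t.
exists (hrow (T t) (x^~ t)); split=> //.
have [IT gTt] := gT _ Itt.
by rewrite /sine_graph/= /tcoord hrow_it hrow_y gTt /x eqxx.
Unshelve. all: by end_near. Qed.

Lemma sine_graph_asymptotic : asymptotic_boundary sine_graph =
  boundary_plane 0 `|` boundary_plane (pi / alpha).
Proof.
apply/seteqP; split=> [p [clp py]|p]; last first.
- case=> -[py pt]; split=> //.
    apply: (@sine_graph_closure p id) => //; rewrite pt.
    exact: cvg_at_right_filter.
  apply: (@sine_graph_closure p (fun t => pi / alpha - t)) => //.
    rewrite pt -[X in _ --> X]subr0; apply: cvgB; first exact: cvg_cst.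
    exact: cvg_at_right_filter.
  move=> t /t_itvE[t0 tp]; split.
    by apply/t_itvE; rewrite subr_gt0 ltrBlDr ltrDl.
  have -> : pi / alpha = 2 * (pi / 2 / alpha) by field; rewrite gt_eqF.
  exact: sine_profile_sym.
suff [|] : tcoord p = 0 \/ tcoord p = pi / alpha by [left|right].
have [t0|t0|->] := ltgtP (tcoord p) 0; [| |by left].
  have [q [[/t_itvE[q0 _] _] /= qn]] := clp [set q | tcoord q < 0]
    (tcoord_continuous (lt_nbhsl t0)).
  by rewrite ltNge (ltW q0) in qn.
have [tp|tp|->] := ltgtP (tcoord p) (pi / alpha); [| |by right].
  (* At an interior height the profile is positive. Near [p], y is below half of its value there
     while the profile stays above it, so no point of the graph is close to [p]. *)
  have It : t_itv alpha (tcoord p) by apply/t_itvE.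
  have gt0 := sine_profile_gt0 a0 c0 It.
  have cg := is_derive_continuous (is_derive_sine_profile a0 c0 It).
  have g2 : sine_profile alpha c (tcoord p) / 2 < sine_profile alpha c (tcoord p).
    by rewrite ltr_pdivrMr// ltr_pMr// ltr1n.
  have y2 : ycoord p < sine_profile alpha c (tcoord p) / 2 by rewrite py divr_gt0.
  have B1 := ycoord_continuous (lt_nbhsl y2).
  have B2 := tcoord_continuous (cg _ (lt_nbhsr g2)).
  have C1 : nbhs p [set q | ycoord q < sine_profile alpha c (tcoord p) / 2].
    exact: B1.
  have C2 : nbhs p [set q | sine_profile alpha c (tcoord p) / 2 <
    sine_profile alpha c (tcoord q)] by exact: B2.
  have [q [[_ yq] [/= q1 q2]]] := clp _ (filterI C1 C2).
  by move: q1; rewrite yq ltNge ltW.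
have [q [[/t_itvE[_ q1] _] /= qn]] := clp [set q | pi / alpha < tcoord q]
  (tcoord_continuous (lt_nbhsr tp)).
by rewrite ltNge (ltW q1) in qn.
Qed.

End SineGraph.

(** * Completeness *)

Section CurveLength.
Variables (R : realType) (n : nat).
Local Notation it := (it n).
Local Notation G := (@HnR_metric R n).
Local Notation hpoint := (hpoint R n).
Implicit Types (gam : R -> hpoint) (f df : R -> R).

Definition speed gam (s : R) : R :=
  Num.sqrt (inner G (gam s) (derive1 gam s) (derive1 gam s)).

Lemma continuous_sum (T : topologicalType) N (F : 'I_N -> T -> R) (p : T) :
  (forall i, {for p, continuous (F i)}) ->
  {for p, continuous (fun x => \sum_i F i x)}.
Proof.
move=> cF; apply: cvg_big => [|i _]; last exact: cF.
exact: add_continuous.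
Qed.

Lemma hdot_ge0 (v : hpoint) : 0 <= hdot v v.
Proof. by apply: sumr_ge0 => j _; rewrite -expr2 sqr_ge0. Qed.

Lemma inner_ge0 (p v : hpoint) : 0 <= inner G p v v.
Proof.
rewrite innerE addr_ge0// -?expr2 ?sqr_ge0// mulr_ge0 ?hdot_ge0//.
by rewrite invr_ge0 sqr_ge0.
Qed.

Lemma curve_coord gam l (s : R) : C1_curve gam ->
  is_derive s 1 (fun s => gam s 0 l) (derive1 gam s 0 l).
Proof.
move=> /(_ s)[dg _]; rewrite derive1E derive_mx// mxE.
by apply: derivableP; move/derivable_mxP : dg; exact.
Qed.

Lemma curve_coord_continuous gam l (s : R) : C1_curve gam ->
  {for s, continuous (fun s => gam s 0 l)} /\
  {for s, continuous (fun s => derive1 gam s 0 l)}.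
Proof.
move=> C1; split; first exact: is_derive_continuous (curve_coord l s C1).
have [_ cg] := C1 s.
by apply: (continuous_comp cg (f := derive1 gam) (g := fun v : hpoint => v 0 l));
  exact: coord_continuous.
Qed.

Lemma speed_continuous gam s : C1_curve gam -> 0 < ycoord (gam s) ->
  {for s, continuous (speed gam)}.
Proof.
move=> C1 y0; pose sq s := derive1 gam s 0 it * derive1 gam s 0 it +
  ycoord (gam s) ^- 2 * hdot (derive1 gam s) (derive1 gam s).
have -> : speed gam = Num.sqrt \o sq by apply/funext => z; rewrite /speed innerE.
have c l := (curve_coord_continuous l s C1).
have cs : {for s, continuous sq}.
  apply: continuousD; first exact: (continuousM (c it).2 (c it).2).
  apply: continuousM; last first.
    by apply: continuous_sum => j; exact: (continuousM (c _).2 (c _).2).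
  apply: continuousV; first by rewrite expf_neq0// gt_eqF.
  exact: (continuousM (c (iy n)).1 (c (iy n)).1).
by apply: continuous_comp => //; exact: sqrt_continuous.
Qed.

Let mu := @lebesgue_measure R.
Let I01 : set R := `[0, 1]%classic.

Lemma continuous_I01_measurable f : (forall s : R, 0 <= s <= 1 ->
  {for s, continuous f}) -> measurable_fun I01 (EFin \o f).
Proof.
move=> cf; have mI : measurable I01 by exact: measurable_itv.
have cw : {within I01, continuous f}.
  by apply: continuous_in_subspaceT => s; rewrite inE /I01/= in_itv/=; exact: cf.
by apply/measurable_EFinP; exact: subspace_continuous_measurable_fun cw.
Qed.

(** The variation of [f] is at most the integral of |f'|, which the speed dominates. It is applied
    to functions on the hypersurface that are 1-Lipschitz for the metric. *)
Lemma curve_length_ge gam f df : C1_curve gam ->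
  (forall s : R, 0 <= s <= 1 -> 0 < ycoord (gam s)) ->
  (forall s : R, 0 <= s <= 1 -> is_derive s 1 f (df s)) ->
  (forall s : R, 0 <= s <= 1 -> {for s, continuous df}) ->
  (forall s : R, 0 <= s <= 1 ->
    df s ^+ 2 <= inner G (gam s) (derive1 gam s) (derive1 gam s)) ->
  (`|f 1 - f 0|%:E <= curve_length G gam)%E.
Proof.
move=> C1 y0 dfE cdf df_le.
have in01 s : s \in `[0, 1] = (0 <= s <= 1) by rewrite in_itv.
have cf s : 0 <= s <= 1 -> {for s, continuous f}.
  by move=> /dfE/is_derive_continuous.
have FTC : (\int[mu]_(s in I01) (df s)%:E = (f 1)%:E - (f 0)%:E)%E.
  apply: continuous_FTC2 => //.
  - by apply: continuous_in_subspaceT => s; rewrite inE /I01/= in01; exact: cdf.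
  - split.
    + move=> s; rewrite in_itv/= => /andP[s0 s1].
      by have [] : is_derive s 1 f (df s) by apply: dfE; rewrite !ltW.
    + by apply: cvg_at_right_filter; apply: cf; rewrite lexx ler01.
    + by apply: cvg_at_left_filter; apply: cf; rewrite lexx ler01.
  - move=> s; rewrite in_itv/= => /andP[s0 s1].
    by apply: is_derive_derive1; apply: dfE; rewrite !ltW.
have mdf := continuous_I01_measurable cdf.
have mI : measurable I01 by exact: measurable_itv.
rewrite -abse_EFin EFinB -FTC; apply: (le_trans (le_abse_integral mu mI mdf)).
apply: ge0_le_integral => //.
- exact: measurableT_comp.
- apply: continuous_I01_measurable => s s01.
  by apply: speed_continuous => //; exact: y0.
- move=> s; rewrite /I01/= in01 => s01.
  by rewrite lee_fin -sqrtr_sqr ler_sqrt ?inner_ge0// df_le.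
Qed.

Lemma curve_length_le gam (M : R) : C1_curve gam -> 0 <= M ->
  (forall s : R, 0 <= s <= 1 -> 0 < ycoord (gam s)) ->
  (forall s : R, 0 <= s <= 1 ->
    inner G (gam s) (derive1 gam s) (derive1 gam s) <= M ^+ 2) ->
  (curve_length G gam <= M%:E)%E.
Proof.
move=> C1 M0 y0 le_M.
have -> : (M%:E = \int[mu]_(s in I01) cst M%:E s)%E.
  have mI : measurable I01 by exact: measurable_itv.
  have mu1 : mu I01 = 1%E.
    by rewrite /mu /I01 lebesgue_measure_itv/= lte_fin ltr01 oppr0 adde0.
  transitivity (M%:E * mu I01)%E; first by rewrite mu1 mule1.
  exact/esym/(integral_cst mu mI).
apply: ge0_le_integral => //.
- apply: continuous_I01_measurable => s s01.
  by apply: speed_continuous => //; exact: y0.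
- move=> s; rewrite /I01/= in_itv/= => s01.
  by rewrite lee_fin -[leRHS]ger0_norm// -sqrtr_sqr ler_sqrt ?sqr_ge0// le_M.
Qed.

Section IntrinsicDistance.
Variables (S : set hpoint) (e : R).
Hypothesis S_gt0 : forall p, S p -> 0 < ycoord p.
Hypothesis S_le : forall p, S p -> ycoord p <= e.

(** An infimum below [eps] is witnessed by an actual curve shorter than [eps]. *)
Lemma intrinsic_dist_lt p q (eps : R) (F : hpoint -> R) :
  (intrinsic_dist G S p q < eps%:E)%E ->
  (forall gam, C1_curve gam -> (forall s : R, 0 <= s <= 1 -> S (gam s)) ->
    (`|F (gam 1) - F (gam 0)|%:E <= curve_length G gam)%E) ->
  `|F q - F p| < eps.
Proof.
move=> /ereal_inf_lt[_ [gam [C1 <- <- Sg] <-]] lt H.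
by rewrite -lte_fin (le_lt_trans _ lt)//; exact: H.
Qed.

Lemma intrinsic_dist_t p q (eps : R) :
  (intrinsic_dist G S p q < eps%:E)%E -> `|tcoord q - tcoord p| < eps.
Proof.
move=> /intrinsic_dist_lt; apply => gam C1 Sg.
apply: (@curve_length_ge _ (fun s => tcoord (gam s))
  (fun s => derive1 gam s 0 it)) => // s s01.
- exact/S_gt0/Sg.
- exact: curve_coord.
- exact: (curve_coord_continuous _ _ C1).2.
- rewrite innerE -expr2 lerDl mulr_ge0 ?hdot_ge0//.
  by rewrite invr_ge0 sqr_ge0.
Qed.

Lemma hdot_ge_sqr (v : hpoint) j : v 0 (lift it j) ^+ 2 <= hdot v v.
Proof.
rewrite /hdot (bigD1 j)//= -expr2 lerDl; apply: sumr_ge0 => k _.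
by rewrite -expr2 sqr_ge0.
Qed.

(** Division by [e] compensates for the conformal factor: y <= e gives |dx| / e <= |dx| / y. *)
Lemma intrinsic_dist_x p q (eps : R) j :
  (intrinsic_dist G S p q < eps%:E)%E ->
  `|q 0 (lift it j) / e - p 0 (lift it j) / e| < eps.
Proof.
move=> dpq.
apply: (intrinsic_dist_lt (F := fun p => p 0 (lift it j) / e) dpq) => gam C1 Sg.
apply: (@curve_length_ge _ (fun s => gam s 0 (lift it j) / e)
  (fun s => derive1 gam s 0 (lift it j) / e)) => // s s01.
- exact/S_gt0/Sg.
- apply: (is_derive_eq (is_derive_mul (curve_coord (lift it j) s C1)
    (is_derive_cst e^-1 s 1))).
  by rewrite mulr0 addr0.
- apply: continuousM; last exact: cst_continuous.
  exact: (curve_coord_continuous _ _ C1).2.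
- have y0 := S_gt0 (Sg _ s01); have ye := S_le (Sg _ s01).
  have e0 : 0 < e := lt_le_trans y0 ye.
  rewrite innerE -expr2 ler_wpDl ?sqr_ge0// expr_div_n mulrC.
  apply: ler_pM; rewrite ?invr_ge0 ?sqr_ge0//; last exact: hdot_ge_sqr.
  by rewrite lef_pV2 ?posrE ?exprn_gt0// ler_pXn2r// nnegrE ltW.
Qed.

Lemma intrinsic_dist_lny p q (eps : R) :
  (intrinsic_dist G S p q < eps%:E)%E ->
  `|ln (ycoord q) - ln (ycoord p)| < eps.
Proof.
move=> dpq.
apply: (intrinsic_dist_lt (F := fun p => ln (ycoord p)) dpq) => gam C1 Sg.
apply: (@curve_length_ge _ (fun s => ln (ycoord (gam s)))
  (fun s => (ycoord (gam s))^-1 * derive1 gam s 0 (iy n))) => // s s01.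
- exact/S_gt0/Sg.
- have dy := curve_coord (iy n) s C1.
  exact: (is_derive_comp (g := fun s => ycoord (gam s))
    (is_derive1_ln (S_gt0 (Sg _ s01))) dy).
- have y0 := S_gt0 (Sg _ s01); have [c1 c2] := curve_coord_continuous (iy n) s C1.
  by apply: continuousM => //; apply: continuousV => //; rewrite gt_eqF.
- rewrite innerE -expr2 ler_wpDl ?sqr_ge0// exprMn exprVn ler_wpM2l//.
    by rewrite invr_ge0 sqr_ge0.
  exact: hdot_ge_sqr.
Qed.

End IntrinsicDistance.
End CurveLength.

(** * Explicit curves and upper bounds for the intrinsic distance *)

Section Completeness.
Variables (R : realType) (n : nat) (alpha c : R).
Hypotheses (a0 : 0 < alpha) (c0 : 0 < c).
Local Notation it := (it n).
Local Notation iy := (iy n).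
Local Notation last := (@ord_max n.-1).
Local Notation hpoint := (hpoint R n).
Local Notation G := (@HnR_metric R n).
Local Notation S := (@sine_graph R n alpha c).
Let g := sine_profile alpha c.

(** A smooth passage from 0 at s = 0 to 1 at s = 1 whose values stay in [0, 1] for every real s, so
    that curves built from it remain on the hypersurface on the whole line. *)
Definition ramp (s : R) : R := sin (pi / 2 * s) ^+ 2.
Definition dramp (s : R) : R := pi * (sin (pi / 2 * s) * cos (pi / 2 * s)).

Lemma ramp_ge0 s : 0 <= ramp s.
Proof. exact: sqr_ge0. Qed.

Lemma ramp_le1 s : ramp s <= 1.
Proof. by rewrite -(cos2Dsin2 (pi / 2 * s)) lerDr sqr_ge0. Qed.

Lemma ramp0 : ramp 0 = 0.
Proof. by rewrite /ramp mulr0 sin0 expr0n. Qed.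

Lemma ramp1 : ramp 1 = 1.
Proof. by rewrite /ramp mulr1 sin_pihalf expr1n. Qed.

Lemma is_derive_ramp (s : R) : is_derive s 1 ramp (dramp s).
Proof.
apply: (is_derive_eq (is_derive_exp 1 (is_derive_sin_alpha (pi / 2) s))).
by rewrite /dramp expr1; field.
Qed.

Lemma dramp_continuous (s : R) : {for s, continuous dramp}.
Proof.
have cs := is_derive_continuous (is_derive_sin_alpha (pi / 2) s).
have cc := is_derive_continuous (is_derive_cos_alpha (pi / 2) s).
by apply: continuousM; [exact: cst_continuous|exact: (continuousM cs cc)].
Qed.

Lemma dramp_sqr_le s : dramp s ^+ 2 <= pi ^+ 2.
Proof.
rewrite /dramp [_ ^+ 2]exprMn; apply: ler_piMr; first exact: sqr_ge0.
rewrite exprMn.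
have le1 x y : x ^+ 2 + y ^+ 2 = 1 -> x ^+ 2 <= 1 :> R.
  by move=> <-; rewrite lerDl sqr_ge0.
have s1 := le1 _ _ (etrans (addrC _ _) (cos2Dsin2 (pi / 2 * s))).
have c1 := le1 _ _ (cos2Dsin2 (pi / 2 * s)).
by rewrite mulr_ile1 ?sqr_ge0.
Qed.

Section Path.
Variables (q p : hpoint).
Hypotheses (Sq : S q) (Sp : S p).

Definition path_t (s : R) : R := tcoord q + ramp s * (tcoord p - tcoord q).

(** The coordinates x and t are interpolated along the segment from [q] to [p]; y is then dictated
    by the hypersurface. *)
Definition ramp_path (s : R) : hpoint :=
  hrow (path_t s) (fun j => if j == last then g (path_t s) else
    q 0 (lift it j) + ramp s * (p 0 (lift it j) - q 0 (lift it j))).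

Definition dramp_path (s : R) : hpoint :=
  hrow (dramp s * (tcoord p - tcoord q)) (fun j => dramp s *
    (if j == last then g (path_t s) * cot alpha (path_t s) * (tcoord p - tcoord q)
     else p 0 (lift it j) - q 0 (lift it j))).

Lemma path_t_itv s : t_itv alpha (path_t s).
Proof.
have [Itp _] := Sp; have [Itq _] := Sq.
have h0 := ramp_ge0 s; have h1 := ramp_le1 s.
have itvI : is_interval (t_itv alpha) by exact: interval_is_interval.
rewrite /path_t; have [pq|qp] := leP (tcoord p) (tcoord q).
  by apply: (itvI _ _ Itp Itq); nra.
by apply: (itvI _ _ Itq Itp); nra.
Qed.

Lemma path_t_dist s : `|path_t s - tcoord p| <= `|tcoord q - tcoord p|.
Proof.
have -> : path_t s - tcoord p = (1 - ramp s) * (tcoord q - tcoord p).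
  by rewrite /path_t; ring.
rewrite normrM ger0_norm ?subr_ge0 ?ramp_le1// ler_piMl//.
by rewrite gerBl ramp_ge0.
Qed.

Lemma path_graph s : S (ramp_path s).
Proof.
rewrite /sine_graph/= /ramp_path /tcoord hrow_it hrow_y eqxx.
by split=> //; exact: path_t_itv.
Qed.

Lemma graph_eq_hrow (r : hpoint) : S r ->
  r = hrow (tcoord r)
    (fun j => if j == last then g (tcoord r) else r 0 (lift it j)).
Proof.
move=> [_ yr]; apply: hrowP => // j; have [->|//] := eqVneq j last.
exact: yr.
Qed.

Lemma path0 : ramp_path 0 = q.
Proof.
rewrite [RHS](graph_eq_hrow Sq) /ramp_path /path_t ramp0 !mul0r !addr0.
apply: hrowP; first by rewrite hrow_it.
by move=> j; rewrite hrow_lift; case: eqP => // _; rewrite mul0r addr0.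
Qed.

Lemma path1 : ramp_path 1 = p.
Proof.
rewrite [RHS](graph_eq_hrow Sp) /ramp_path /path_t ramp1 !mul1r !subrKC.
apply: hrowP; first by rewrite hrow_it.
by move=> j; rewrite hrow_lift; case: eqP => // _; rewrite mul1r subrKC.
Qed.

Lemma is_derive_affine (a b s : R) :
  is_derive s 1 (fun s => a + ramp s * b) (dramp s * b).
Proof.
apply: (is_derive_eq (is_derive_add (is_derive_cst a s 1)
  (is_derive_mul (is_derive_ramp s) (is_derive_cst b s 1)))).
by rewrite mulr0 addr0 add0r.
Qed.

Lemma is_derive_path (s : R) : is_derive s 1 ramp_path (dramp_path s).
Proof.
apply: is_derive_row => l; have [j ->|->] := unliftP it l; last first.
  rewrite hrow_it (_ : (fun s => ramp_path s 0 it) = path_t).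
    exact: is_derive_affine.
  by apply/funext => z; exact: hrow_it.
rewrite hrow_lift (_ : (fun s => ramp_path s 0 (lift it j)) = fun s =>
  if j == last then g (path_t s) else
  q 0 (lift it j) + ramp s * (p 0 (lift it j) - q 0 (lift it j))); last first.
  by apply/funext => z; exact: hrow_lift.
case: (j == last); last exact: is_derive_affine.
have dg := is_derive_sine_profile a0 c0 (path_t_itv s).
have dt : is_derive s 1 path_t (dramp s * (tcoord p - tcoord q)).
  exact: is_derive_affine.
apply: (is_derive_eq (is_derive_comp dg dt)).
by rewrite /g; ring.
Qed.

Lemma path_C1 : C1_curve ramp_path.
Proof.
move=> s; split; first by have [] := is_derive_path s.
have -> : derive1 ramp_path = dramp_path.
  by apply/funext => z; rewrite derive1E; have [] := is_derive_path z.
have cd := @dramp_continuous s.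
have ct : {for s, continuous path_t}.
  exact: is_derive_continuous (is_derive_affine _ _ s).
have cg := is_derive_continuous (is_derive_sine_profile a0 c0 (path_t_itv s)).
have cc := is_derive_continuous (is_derive_cot a0 (path_t_itv s)).
have cgt : {for s, continuous (g \o path_t)} by exact: continuous_comp.
have cct : {for s, continuous (cot alpha \o path_t)} by exact: continuous_comp.
apply: (@cvg_row _ _ (nbhs s) (nbhs_filter s)) => l.
have [j ->|->] := unliftP it l; last first.
  rewrite hrow_it (_ : (fun s => dramp_path s 0 it) =
      fun s => dramp s * (tcoord p - tcoord q)).
    by apply: continuousM => //; exact: cst_continuous.
  by apply/funext => z; exact: hrow_it.
rewrite hrow_lift (_ : (fun s => dramp_path s 0 (lift it j)) = fun s => dramp s *
    (if j == last then g (path_t s) * cot alpha (path_t s) * (tcoord p - tcoord q)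
     else p 0 (lift it j) - q 0 (lift it j))); last first.
  by apply/funext => z; exact: hrow_lift.
apply: continuousM => //; case: (j == last); last exact: cst_continuous.
apply: continuousM; last exact: cst_continuous.
exact: (continuousM cgt cct).
Qed.

Definition sqdist : R := \sum_l (q 0 l - p 0 l) ^+ 2.

(** Since g' = g cot, the t and y components together contribute 1 + cot^2 times the squared
    difference in t, the factor g^2 cancelling the metric coefficient. The x components contribute
    g^(-2), and pi bounds the derivative of the ramp. *)
Lemma path_speed (K s : R) : 1 + cot alpha (path_t s) ^+ 2 <= K ->
  g (path_t s) ^- 2 <= K ->
  inner G (ramp_path s) (dramp_path s) (dramp_path s) <= pi ^+ 2 * K * sqdist.
Proof.
move=> K1 K2; have gt := sine_profile_gt0 a0 c0 (path_t_itv s).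
rewrite innerE hrow_it hrow_y eqxx -/g.
pose X := \sum_(j < n.-1.+1 | j != last)
  (q 0 (lift it j) - p 0 (lift it j)) ^+ 2.
have X0 : 0 <= X by apply: sumr_ge0 => j _; exact: sqr_ge0.
have hE : hdot (dramp_path s) (dramp_path s) = dramp s ^+ 2 *
    ((g (path_t s) * cot alpha (path_t s)) ^+ 2 * (tcoord q - tcoord p) ^+ 2 + X).
  rewrite /hdot (bigD1 last)//= !hrow_lift eqxx [RHS]mulrDr /X mulr_sumr.
  congr (_ + _).
    by ring.
  by apply: eq_bigr => j /negPf jl; rewrite hrow_lift jl; ring.
rewrite hE; set k := cot _ _ in K1 *; set y := g _ in gt K2 *.
set d := tcoord q - tcoord p.
have -> : dramp s * (tcoord p - tcoord q) * (dramp s * (tcoord p - tcoord q)) +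
    y ^- 2 * (dramp s ^+ 2 * ((y * k) ^+ 2 * d ^+ 2 + X)) =
    dramp s ^+ 2 * ((1 + k ^+ 2) * d ^+ 2 + y ^- 2 * X).
  by rewrite /d; field; rewrite gt_eqF.
have K0 : 0 <= K by rewrite (le_trans _ K2)// invr_ge0 sqr_ge0.
(* The squared difference in y, present in [sqdist], is discarded. *)
have dX : d ^+ 2 + X <= sqdist.
  rewrite /sqdist sum_ambient lerD2l [leRHS](bigD1 last)//= lerDr.
  exact: sqr_ge0.
rewrite -mulrA; apply: ler_pM; rewrite ?sqr_ge0 ?dramp_sqr_le//.
  apply: addr_ge0; apply: mulr_ge0; rewrite // ?invr_ge0 ?sqr_ge0//.
  by rewrite addr_ge0// sqr_ge0.
apply: (@le_trans _ _ (K * (d ^+ 2 + X))); last exact: ler_wpM2l.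
by rewrite mulrDr lerD// ler_wpM2r// sqr_ge0.
Qed.

Lemma intrinsic_dist_path (K : R) : 0 <= K ->
  (forall t, `|t - tcoord p| <= `|tcoord q - tcoord p| ->
     1 + cot alpha t ^+ 2 <= K /\ g t ^- 2 <= K) ->
  (intrinsic_dist G S q p <= (Num.sqrt (pi ^+ 2 * K * sqdist))%:E)%E.
Proof.
move=> K0 Kt; apply: (@le_trans _ _ (curve_length G ramp_path)).
  apply: ereal_inf_lbound; exists ramp_path => //; split.
  - exact: path_C1.
  - exact: path0.
  - exact: path1.
  - by move=> s _; exact: path_graph.
have N0 : 0 <= pi ^+ 2 * K * sqdist.
  by rewrite !mulr_ge0// ?pi_ge0// sumr_ge0// => l _; exact: sqr_ge0.
apply: curve_length_le => [||s _|s _].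
- exact: path_C1.
- exact: sqrtr_ge0.
- have [It ->] := path_graph s; exact: sine_profile_gt0.
- have -> : derive1 ramp_path s = dramp_path s.
    by rewrite derive1E; have [] := is_derive_path s.
  rewrite sqr_sqrtr//; have [K1 K2] := Kt _ (path_t_dist s).
  exact: path_speed.
Qed.

End Path.
End Completeness.

Lemma cauchy_real_cvg (R : realType) (a : nat -> R) :
  (forall e : R, 0 < e -> exists N, forall i j, (N <= i)%N -> (N <= j)%N ->
     `|a i - a j| < e) -> exists l : R, a i @[i --> \oo] --> l.
Proof.
move=> ca; apply/cvg_ex/cauchy_cvgP/cauchy_exP => e e0.
have [N NP] := ca _ e0; exists (a N).
by exists N => // i /= Ni; exact: NP.
Qed.

(** * Limits of Cauchy sequences *)

Section SineGraphComplete.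
Variables (R : realType) (n : nat) (alpha c : R).
Hypotheses (a0 : 0 < alpha) (c0 : 0 < c).
Local Notation it := (it n).
Local Notation last := (@ord_max n.-1).
Local Notation hpoint := (hpoint R n).
Local Notation G := (@HnR_metric R n).
Local Notation S := (@sine_graph R n alpha c).
Let g := sine_profile alpha c.
Let e := c `^ alpha^-1.

(** Near [p] one constant [K] bounds both coefficients of the speed, by continuity in t. The
    explicit curve then has length at most a multiple of the Euclidean distance, so coordinatewise
    convergence on the hypersurface implies intrinsic convergence. *)
Lemma intrinsic_dist_near (p : hpoint) (eps : R) : S p -> 0 < eps ->
  \forall q \near p, S q -> (intrinsic_dist G S q p < eps%:E)%E.
Proof.
move=> Sp eps0; have [Itp _] := Sp.
have gt := sine_profile_gt0 a0 c0 Itp.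
pose k1 t := 1 + cot alpha t * cot alpha t.
pose k2 t := (g t * g t)^-1.
(* The added 1 makes the bounds strict at [p], so that they persist nearby. *)
pose K := `|k1 (tcoord p)| + `|k2 (tcoord p)| + 1.
have K0 : 0 <= K by rewrite !addr_ge0.
have cc := is_derive_continuous (is_derive_cot a0 Itp).
have cg := is_derive_continuous (is_derive_sine_profile a0 c0 Itp).
have ck1 : {for tcoord p, continuous k1}.
  by apply: continuousD; [exact: cst_continuous|exact: (continuousM cc cc)].
have ck2 : {for tcoord p, continuous k2}.
  apply: continuousV; last exact: (continuousM cg cg).
  by rewrite mulf_neq0// gt_eqF.
have k1K : k1 (tcoord p) < K.
  by rewrite /K ltr_pwDr// (le_trans (ler_norm _))// lerDl.
have k2K : k2 (tcoord p) < K.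
  by rewrite /K ltr_pwDr// (le_trans (ler_norm _))// lerDr.
have nk1 : \forall t \near tcoord p, k1 t < K := ck1 _ (lt_nbhsl k1K).
have nk2 : \forall t \near tcoord p, k2 t < K := ck2 _ (lt_nbhsl k2K).
have nk : nbhs (tcoord p) [set t | k1 t < K /\ k2 t < K].
  exact: filterI nk1 nk2.
have [d /= d0 dP] := (nbhs_ballP _ _).1 nk.
pose D (q : hpoint) : R := pi ^+ 2 * K * sqdist q p.
have cD : {for p, continuous D}.
  apply: continuousM; first exact: cst_continuous.
  apply: continuous_sum => l.
  have cl : {for p, continuous (fun q : hpoint => q 0 l - p 0 l)}.
    by apply: continuousB; [exact: coord_continuous|exact: cst_continuous].
  exact: (continuousM cl cl).
have Dp : D p = 0.
  by rewrite /D /sqdist big1 ?mulr0// => l _; rewrite subrr expr0n.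
have Deps : D p < eps ^+ 2 by rewrite Dp exprn_gt0.
have n1 : \forall q \near p, D q < eps ^+ 2 := cD _ (lt_nbhsl Deps).
have n2 : \forall q \near p, `|tcoord p - tcoord q| < d.
  exact: (tcoord_continuous (nbhsx_ballx _ _ d0)).
apply: filterS2 n1 n2 => q q1 q2 Sq.
apply: (@le_lt_trans _ _ (Num.sqrt (D q))%:E).
  apply: intrinsic_dist_path => // t tq.
  have [] := dP t; last by rewrite /k1 /k2 -!expr2 => /ltW ? /ltW ?.
  by rewrite /ball/= distrC (le_lt_trans tq)// distrC.
rewrite lte_fin -[ltRHS](@ger0_norm _ eps) ?ltW// -sqrtr_sqr.
by rewrite ltr_sqrt// exprn_gt0.
Qed.

Lemma sine_graph_complete : complete_submanifold G S.
Proof.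
move=> u Su uC.
have S_gt0 p : S p -> 0 < ycoord p.
  by move=> [It ->]; exact: sine_profile_gt0.
have S_le p : S p -> ycoord p <= e.
  by move=> [It ->]; exact: sine_profile_le.
have e0 : 0 < e by exact: powR_gt0.
have [tl tP] : exists l : R, tcoord (u i) @[i --> \oo] --> l.
  apply: cauchy_real_cvg => eps /uC[N NP]; exists N => i j Ni Nj.
  exact: (intrinsic_dist_t S_gt0 (NP _ _ Nj Ni)).
have [yl yP] : exists l : R, ln (ycoord (u i)) @[i --> \oo] --> l.
  apply: cauchy_real_cvg => eps /uC[N NP]; exists N => i j Ni Nj.
  exact: (intrinsic_dist_lny S_gt0 (NP _ _ Nj Ni)).
have cx (j : 'I_n.-1.+1) : exists l : R,
    u i 0 (lift it j) / e @[i --> \oo] --> l.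
  apply: cauchy_real_cvg => eps /uC[N NP]; exists N => i k Ni Nk.
  exact: (intrinsic_dist_x S_gt0 S_le j (NP _ _ Nk Ni)).
have [x xP] := choice cx.
(* On the hypersurface c sin(alpha t) = y^alpha = exp(alpha ln y); both sides are passed to the
   limit. *)
have sE : c * sin (alpha * tl) = expR (alpha * yl).
  have l1 : c * sin (alpha * tcoord (u i)) @[i --> \oo] --> c * sin (alpha * tl).
    have cs := is_derive_continuous (is_derive_sin_alpha alpha tl).
    apply: cvgM; first exact: cvg_cst.
    exact: (cvg_comp _ _ tP cs).
  have l2 : c * sin (alpha * tcoord (u i)) @[i --> \oo] --> expR (alpha * yl).
    rewrite (_ : (fun i => _) = fun i => expR (alpha * ln (ycoord (u i)))).
      have l3 : alpha * ln (ycoord (u i)) @[i --> \oo] --> alpha * yl.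
        by apply: cvgM; [exact: cvg_cst|].
      exact: (cvg_comp _ _ l3 (@continuous_expR R (alpha * yl))).
    apply/funext => i; have [It yE] := Su i.
    have st := sin_gt0_t_itv a0 It.
    rewrite -(sine_profile_powR a0 c0 (ltW st)) -yE /powR.
    by rewrite gt_eqF// S_gt0.
  exact: (cvg_unique _ l1 l2).
(* Limits give only weak inequalities. At either endpoint the sine would vanish, whereas [sE]
   equates a multiple of it with an exponential. *)
have Itl : t_itv alpha tl.
  have tge : 0 <= tl.
    apply: (cvgr_to_ge tP); apply: nearW => i.
    by have [/t_itvE[/ltW ? _] _] := Su i.
  have tle : tl <= pi / alpha.
    apply: (cvgr_to_le tP); apply: nearW => i.
    by have [/t_itvE[_ /ltW ?] _] := Su i.
  have sN0 : sin (alpha * tl) != 0.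
    apply/eqP => s0; have := expR_gt0 (alpha * yl).
    by rewrite -sE s0 mulr0 ltxx.
  apply/t_itvE; rewrite !lt_neqAle tge tle !andbT; split.
    by apply: contraNneq sN0 => <-; rewrite mulr0 sin0.
  apply: contraNneq sN0 => ->.
  by rewrite mulrC divfK ?sinpi// gt_eqF.
(* The y-coordinate is defined from the limit of t, which places [p] on the hypersurface; the factor
   [e] undoes the normalization of the x-coordinates. *)
pose p : hpoint := hrow tl (fun j => if j == last then g tl else x j * e).
have Sp : S p by rewrite /sine_graph/= /tcoord hrow_it hrow_y eqxx.
exists p => // eps eps0.
have up : u i @[i --> \oo] --> p.
  apply: cvg_row => l; have [j ->|->] := unliftP it l; last by rewrite hrow_it.
  rewrite hrow_lift; have [->|jl] := eqVneq j last.
    rewrite (_ : (fun i => _) = fun i => g (tcoord (u i))); last first.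
      by apply/funext => i; have [_ yE] := Su i.
    apply: (cvg_comp _ _ tP).
    exact: (is_derive_continuous (is_derive_sine_profile a0 c0 Itl)).
  rewrite (_ : (fun i => _) = fun i => u i 0 (lift it j) / e * e); last first.
    by apply/funext => i; rewrite divfK// gt_eqF.
  by apply: cvgM; [exact: xP|exact: cvg_cst].
have [N _ NP] := up _ (intrinsic_dist_near Sp eps0).
by exists N => i Ni; exact: (NP i Ni (Su i)).
Qed.

End SineGraphComplete.

Theorem theorem5p2 (R : realType) (n r : nat)
    (hn : (2 <= n)%N) (hr : (1 <= r <= n)%N) :
  [/\ forall (I : set R) (lam : R -> R),
        maximal_parabolic_solution n r I lam <->
        [\/ I = [set y | 0 < y] /\ exists b : R, forall y, I y -> lam y = b,
            n = r /\ exists2 c : R, 0 < c &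
              vertically_congruent I lam [set y | 0 < y] (log_profile c)
          | (r < n)%N /\ exists2 c : R, 0 < c &
              vertically_congruent I lam
                `]0, arcsin_end n r c[ (arcsin_profile n r c)],
      n = r -> forall c : R, 0 < c ->
        entire_vertical_graph (vgraph n [set y | 0 < y] (log_profile c))
    & (r < n)%N -> forall c : R, 0 < c ->
        exists t0 : R,
          arcsin_profile n r c y @[y --> (arcsin_end n r c)^'-] --> t0 /\
          let S := glued n (arcsin_profile n r c) (arcsin_end n r c) t0 in
          [/\ exists (D : set (chart R n)) (g : chart R n -> R),
                [/\ horizontal_graph S D g, minimal_graph (iy n) r D g
                  & D <> [set: chart R n]],
              ~ entire_vertical_graph S,
              complete_submanifold (@HnR_metric R n) S,
              parabolic_invariant S
            & exists P Q : set (hpoint R n),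
                parallel_planes n.-1 P Q /\
                asymptotic_boundary S = P `|` Q]].

Proof.
have n_gt0 : (0 < n)%N := ltnW hn.
case: r hr => // s /= sn; split.
- exact: maximal_parabolic_classification.
- move=> ns c c0; exists (log_profile c \o @hyp_y R n).
  by rewrite /vgraph.
move=> sn' c c0; have a0 := arcsin_exponent_gt0 R sn'.
rewrite arcsin_profileE arcsin_endE.
set alpha := arcsin_exponent R n s.+1 in a0 *.
(* The midpoint of (0, pi/alpha), where sin(alpha t) = 1 and y is maximal. *)
exists (pi / 2 / alpha); split; first exact: asin_profile_cvg.
rewrite /= gluedE// -/(@sine_graph R n alpha c); split.
- exists (strip (t_itv alpha)), (sine_profile alpha c \o @hyp_y R n); split.
  + exact: sine_graph_horizontal.
  + exact: sine_profile_minimal.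
  + exact: t_strip_neqT.
- exact: sine_graph_not_entire.
- exact: sine_graph_complete.
- exact: sine_graph_parabolic.
- exists (@boundary_plane R n 0), (@boundary_plane R n (pi / alpha)); split.
    apply: boundary_planes_parallel => E.
    by have := divr_gt0 (pi_gt0 R) a0; rewrite -E ltxx.
  exact: sine_graph_asymptotic.
Qed.
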